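(* For every $H\in\mathbf{K}$, the sets $\mathrm{Shrp}^H=\{K\in\mathbf{K}:\mathrm{Sharp}(K)\text{ is homeomorphic to }H\}$ and $\mathrm{Blr}^H=\{K\in\mathbf{K}:\mathrm{Blur}(K)\text{ is homeomorphic to }H\}$ are $\boldsymbol{\Pi}^1_1$-complete subsets of $\mathbf{K}$.
   Context: $2^{\omega}$ is the Cantor space; $N_s=\{x\in2^\omega:s\subset x\}$; $\mu$ is the coin-tossing measure, $\mu(N_s)=2^{-\mathrm{lh}(s)}$. For measurable $A$, $\mathcal{D}_A(z)=\lim_n\mu(A\cap N_{z\restriction n})/\mu(N_{z\restriction n})$ when it exists. $\mathrm{Blur}(A)$ is the set of $z$ where $\mathcal{D}_A(z)$ does not exist; $\mathrm{Sharp}(A)$ is the set of $z$ where it exists and lies in $(0;1)$. $\mathbf{K}$ is the Polish space of compact subsets of $2^\omega$ with the Vietoris topology. A subset $A$ of a Polish space $X$ is $\boldsymbol{\Pi}^1_1$-complete if it is coanalytic and for every zero-dimensional Polish $Z$ and coanalytic $B\subseteq Z$ there is continuous $f:Z\to X$ with $B=f^{-1}(A)$. *)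

(* Defs.v *)
From HB Require Import structures.
From mathcomp Require Import all_boot all_order all_algebra.
From mathcomp Require Import all_classical all_reals all_analysis.
From mathcomp Require Import Rstruct Rstruct_topology.

Set Implicit Arguments.
Unset Strict Implicit.
Unset Printing Implicit Defensive.
Import Order.TTheory GRing.Theory Num.Theory.
Import numFieldNormedType.Exports.
Local Open Scope classical_set_scope.
Local Open Scope ring_scope.

Definition Real : realType := Rdefinitions.R.

Definition cyl (s : seq bool) : set cantor_space :=
  [set x | forall i, (i < size s)%N -> x i = nth false s i].

Definition restr (z : cantor_space) (n : nat) : seq bool := mkseq z n.

(** Coin-tossing measure, as the outer measure generated by
    mu(N_s) = 2^{-lh(s)} (Caratheodory/Lebesgue construction; on Borel sets,
    in particular on all sets used below, it is the coin-tossing measure). *)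
Definition mu (A : set cantor_space) : \bar Real :=
  ereal_inf [set (\sum_(k <oo) (((2 : Real)^-1) ^+ size (c k))%:E)%E
            | c in [set c : nat -> seq bool | A `<=` \bigcup_k cyl (c k)]].

Definition density_ratio (A : set cantor_space) (z : cantor_space) (n : nat)
  : Real :=
  fine (mu (A `&` cyl (restr z n))) / fine (mu (cyl (restr z n))).

Definition density_exists (A : set cantor_space) (z : cantor_space) : Prop :=
  cvgn (density_ratio A z).

(** D_A(z) (meaningful only when it exists). *)
Definition density (A : set cantor_space) (z : cantor_space) : Real :=
  limn (density_ratio A z).

Definition Blur (A : set cantor_space) : set cantor_space :=
  [set z | ~ density_exists A z].

Definition Sharp (A : set cantor_space) : set cantor_space :=
  [set z | density_exists A z /\ 0 < density A z < 1].

Record compK := CompK { Kset : set cantor_space ; Kset_compact : compact Kset }.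

HB.instance Definition _ := gen_eqMixin compK.
HB.instance Definition _ := gen_choiceMixin compK.

Definition vietoris_subbase (p : bool * set cantor_space) : set compK :=
  if p.1 then [set K | Kset K `<=` p.2]
  else [set K | Kset K `&` p.2 !=set0].

HB.instance Definition _ :=
  @isSubBaseTopological.Build compK (bool * set cantor_space)%type
    [set p | open p.2] vietoris_subbase.

Definition homeomorphic (A B : set cantor_space) : Prop :=
  exists f g : cantor_space -> cantor_space,
    [/\ {within A, continuous f} /\ {within B, continuous g},
        f @` A `<=` B, g @` B `<=` A,
        (forall x, A x -> g (f x) = x) & (forall y, B y -> f (g y) = y)].

Definition separable_space (T : topologicalType) : Prop :=
  exists D : set T, countable D /\ closure D = setT.

Definition completely_metrizable (T : topologicalType) : Prop :=
  exists d : T -> T -> Real,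
    [/\ (forall x y, 0 <= d x y) /\ (forall x y, d x y = 0 <-> x = y),
        (forall x y, d x y = d y x),
        (forall x y z, d x z <= d x y + d y z),
        (forall A : set T, open A <->
           (forall x, A x -> exists2 e : Real, 0 < e & forall y, d x y < e -> A y)) &
        (forall u : nat -> T,
           (forall e : Real, 0 < e -> exists N, forall m n,
               (N <= m)%N -> (N <= n)%N -> d (u m) (u n) < e) ->
           exists x, forall e : Real, 0 < e ->
             exists N, forall n, (N <= n)%N -> d (u n) x < e)].

Definition polish (T : topologicalType) : Prop :=
  separable_space T /\ completely_metrizable T.

Definition zero_dim (T : topologicalType) : Prop :=
  exists B : set (set T), B `<=` clopen /\ basis B.

Definition analytic (X : topologicalType) (A : set X) : Prop :=
  A = set0 \/
  exists (Y : topologicalType) (f : Y -> X),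
    [/\ polish Y, continuous f & range f = A].

Definition coanalytic (X : topologicalType) (A : set X) : Prop :=
  analytic (~` A).

Definition Pi11_complete (X : topologicalType) (A : set X) : Prop :=
  coanalytic A /\
  forall (Z : topologicalType), polish Z -> zero_dim Z ->
    forall B : set Z, coanalytic B ->
      exists f : Z -> X, continuous f /\ B = f @^-1` A.

Definition Shrp (H : compK) : set compK :=
  [set K | homeomorphic (Sharp (Kset K)) (Kset H)].

Definition Blr (H : compK) : set compK :=
  [set K | homeomorphic (Blur (Kset K)) (Kset H)].

(* Main.v *)
(** Hardness. For a set [S] of bit strings and values [v] in [3/8, 5/8], put the
    points of [2^omega] on a "spine" 0 x0 0 x1 0 x2 ..., and fill the cylinders
    leaving the spine by clopen sets whose measures force the compact set to have
    relative measure exactly [v (x|n)] along the spine. Off the spine the density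
    is 0 or 1, so Sharp and Blur are the copies of those branches [x] of [S]
    along which [v] converges, resp. diverges. An analytic set is the set of [z]
    for which a tree [T_z], depending clopenly on [z], has a branch. Coding
    branches by the positions of the ones of a bit sequence and letting [v]
    oscillate or not according to the infinity of ones, one gets Sharp (or Blur)
    equal to a copy of [H] when [T_z] has no branch, and a non-compact set
    otherwise.

    Upper bound. If the section [D_x] of a Borel set is closed, then a countable
    tree built from [x] bounds the ranks of the trees searching for points of
    [D_x], which makes "[D_x] meets the cylinder of [s]" both analytic and
    coanalytic; hence "[D_x] is closed and its tree lies in a coanalytic set" is
    coanalytic. Being homeomorphic to [H] is a coanalytic condition on the tree of
    a closed set by the same principle, applied to the sets of back-and-forth
    systems with [H]: saturated under the homeomorphisms of [H], such a system is
    unique. *)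

Require Import Defs.
From HB Require Import structures.
From mathcomp Require Import all_boot all_order all_algebra.
From mathcomp Require Import all_classical all_reals all_analysis.
From mathcomp Require Import Rstruct Rstruct_topology.
From mathcomp Require Import ring lra zify.
(* Restores [Real], which MathComp shadows. *)
Import Defs.

Set Implicit Arguments.
Unset Strict Implicit.
Unset Printing Implicit Defensive.
Import Order.TTheory GRing.Theory Num.Theory.
Import numFieldNormedType.Exports.
Local Open Scope classical_set_scope.
Local Open Scope ring_scope.

(** * The Cantor space *)

(** The constant bits of the spine open one side cylinder per level. Its measure can be chosen
    freely, so it absorbs the difference between two successive values of [v]. The obstacle in the
    upper bound is that both ingredients look analytic: a prefix of [D_x] is witnessed by a point,
    and a homeomorphism by a pair of maps. For prefixes, the claim that no point extends [s] says
    that a tree is well-founded. It is certified by a strategy embedding that tree into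
    [limit_tree x], a single tree which is well-founded exactly because [D_x] is closed. Strategies
    are maps between countable sets, so they take over the role of ordinal ranks and the certificate
    is analytic. For homeomorphisms, uniqueness of saturated systems makes the set of systems
    closed, and nonemptiness of a closed section is coanalytic by the first point.
    [coanalytic_closed_sections] is thus used twice, nested: for the systems, with nonemptiness as
    the condition on the tree, and for [Sharp] or [Blur], with homeomorphism to [H] as the
    condition. *)

Lemma cylP (s : seq bool) (y : cantor_space) : cyl s y <-> restr y (size s) = s.
Proof.
split=> [h|h i ilt]; last by rewrite -[in RHS]h nth_mkseq.
apply: (@eq_from_nth _ false); rewrite size_mkseq// => i ilt.
by rewrite nth_mkseq// h.
Qed.

Lemma cyl_restr (x y : cantor_space) n :
  cyl (restr x n) y <-> forall i, (i < n)%N -> y i = x i.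
Proof.
rewrite /cyl /= size_mkseq; split=> h i ilt; have := h i ilt; rewrite nth_mkseq//.
Qed.

Lemma cyl_restr_self (x : cantor_space) n : cyl (restr x n) x.
Proof. exact/cyl_restr. Qed.

Lemma restrS (x : cantor_space) n : restr x n.+1 = rcons (restr x n) (x n).
Proof. exact: mkseqS. Qed.

Lemma size_restr (x : cantor_space) n : size (restr x n) = n.
Proof. exact: size_mkseq. Qed.

Lemma cyl_cat (s t : seq bool) : cyl (s ++ t) `<=` cyl s.
Proof.
move=> y h i ilt; rewrite h ?size_cat ?ltn_addr// nth_cat ilt//.
Qed.

Lemma cyl_rconsP (s : seq bool) y : cyl s y -> cyl (rcons s (y (size s))) y.
Proof.
move=> h i; rewrite size_rcons ltnS leq_eqVlt nth_rcons => /orP[/eqP->|ilt].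
  by rewrite ltnn eqxx.
by rewrite ilt h.
Qed.

Lemma cyl_rcons (s : seq bool) b : cyl (rcons s b) `<=` cyl s.
Proof. by rewrite -cats1; apply: cyl_cat. Qed.

Lemma restr_eq (x y : cantor_space) n :
  (forall i, (i < n)%N -> x i = y i) -> restr x n = restr y n.
Proof.
move=> h; apply: (@eq_from_nth _ false); rewrite !size_restr// => i ilt.
by rewrite !nth_mkseq// h.
Qed.

Lemma take_restr (x : cantor_space) i j : (i <= j)%N -> take i (restr x j) = restr x i.
Proof.
move=> ij; rewrite -(subnKC ij) /restr /mkseq iotaD map_cat.
by rewrite take_size_cat ?size_map ?size_iota.
Qed.

Definition app (s : seq bool) (y : cantor_space) : cantor_space :=
  fun i => if (i < size s)%N then nth false s i else y (i - size s)%N.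

Lemma cyl_app s y : cyl s (app s y).
Proof. by move=> i ilt; rewrite /app ilt. Qed.

Lemma restr_app s (x : cantor_space) n :
  restr (app s x) (size s + n) = s ++ restr x n.
Proof.
apply: (@eq_from_nth _ false); rewrite ?size_cat !size_restr// => i ilt.
rewrite nth_mkseq// /app nth_cat; case: ltnP => // si.
by rewrite nth_mkseq// ltn_subLR.
Qed.

Lemma nbhs_cantorP (x : cantor_space) (U : set cantor_space) :
  nbhs x U <-> exists n, cyl (restr x n) `<=` U.
Proof.
split; last first.
  move=> [n nU]; apply: filterS nU _.
  elim: n => [|n IH]; first by apply: filterS filterT => y _; case.
  have hn : nbhs x [set y : cantor_space | y n = x n].
    have /(_ x) c := @proj_continuous _ (fun _ : nat => bool) n.
    have : nbhs (x n) [set b | b = x n] by exact/principal_filterP.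
    by move/c.
  apply: filterS2 IH hn => y /cyl_restr h1 h2.
  apply/cyl_restr => i; rewrite ltnS leq_eqVlt => /orP[/eqP->//|]; exact: h1.
apply: contraPP => nU.
have H n : exists y, cyl (restr x n) y /\ ~ U y.
  by move/forallNP: nU => /(_ n) /existsNP [y /not_implyP[? ?]]; exists y.
have [u hu] := choice H.
have cu : u @ \oo --> x.
  apply/cvg_sup => N V [W] [[W'] oW <-] WfN WU.
  apply: (filterS WU); rewrite nbhs_simpl; exists N.+1 => // i /= iN.
  by have [/cyl_restr/(_ _ iN) e _] := hu i; rewrite /preimage/= e.
have : nbhs x U -> False; last by [].
move=> /cu [N _ hN]; have := hN N (leqnn N); have [_ hNU] := hu N.
by move/hNU.
Qed.

Lemma open_cantorP (U : set cantor_space) :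
  open U <-> forall x, U x -> exists n, cyl (restr x n) `<=` U.
Proof.
rewrite openE; split=> h x Ux; first exact/nbhs_cantorP/h.
exact/nbhs_cantorP/h.
Qed.

Lemma closed_cantorP (A : set cantor_space) :
  closed A <->
  forall x, (forall n, exists2 y, A y & cyl (restr x n) y) -> A x.
Proof.
rewrite -openC open_cantorP; split=> h x.
  move=> hx; apply: contrapT => /h [n hn].
  by have [y Ay /hn] := hx n.
move=> nAx; apply: contrapT => hn; apply/nAx/h => n.
move/forallNP: hn => /(_ n) /existsNP [y /not_implyP[? /contrapT ?]].
by exists y.
Qed.

Lemma closed_avoid (A : set cantor_space) x : closed A -> ~ A x ->
  exists n, forall y, A y -> ~ cyl (restr x n) y.
Proof.
move=> /closed_cantorP cA nAx; apply: contrapT => /forallNP h; apply/nAx/cA => n.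
by have /existsNP[y /not_implyP[Ay /contrapT]] := h n; exists y.
Qed.

Lemma compact_cantorP (A : set cantor_space) : compact A <-> closed A.
Proof.
split; first by apply: compact_closed; exact: cantor_space_hausdorff.
by move=> ?; apply: (subclosed_compact _ cantor_space_compact).
Qed.

Lemma continuous_within_cantorP (A : set cantor_space) (f : cantor_space -> cantor_space) :
  {within A, continuous f} <->
  forall x n, A x -> exists m, forall y, A y -> cyl (restr x m) y ->
    cyl (restr (f x) n) (f y).
Proof.
rewrite subspace_continuousP; split=> h x.
  move=> n Ax; have : nbhs (f x) (cyl (restr (f x) n)).
    by apply/nbhs_cantorP; exists n.
  move/(h x Ax); rewrite /= nbhs_simpl /within /= => /nbhs_cantorP[m hm].
  by exists m => y Ay /hm; apply.
move=> Ax V /nbhs_cantorP[n nV]; have [m hm] := h x n Ax.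
rewrite /= nbhs_simpl /within/=; apply/nbhs_cantorP; exists m => y ym Ay.
by apply/nV/hm.
Qed.

(** Otherwise the strings above which no uniform level works contain a whole branch, and [P] fails
    all along it. Compactness of the Cantor space enters most of the later arguments in this
    form. *)
Lemma fan (P : seq bool -> Prop) :
  (forall s t, P s -> P (s ++ t)) ->
  (forall x : cantor_space, exists n, P (restr x n)) ->
  exists n, forall s, size s = n -> P s.
Proof.
move=> Pmono hP; apply: contrapT => hn.
pose good s := exists n, forall t, size t = n -> P (s ++ t).
have ngood0 : ~ good [::] by case=> n h; apply: hn; exists n.
have step s : ~ good s -> exists b, ~ good (rcons s b).
  move=> ngs; apply: contrapT => /forallNP h; apply: ngs.
  have [n0 h0] := contrapT (h false); have [n1 h1] := contrapT (h true).
  exists (n0 + n1).+1 => -[//|[] t [st]].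
    rewrite -(cat_take_drop n1 t) -cat_rcons catA; apply/Pmono/h1.
    by rewrite size_takel// st leq_addl.
  rewrite -(cat_take_drop n0 t) -cat_rcons catA; apply/Pmono/h0.
  by rewrite size_takel// st leq_addr.
have [|f hf] := @choice _ _ (fun s b => ~ good s -> ~ good (rcons s b)).
  by move=> s; case: (pselect (good s)) => [gs|/step[b hb]]; [exists true|exists b].
pose fix u n := if n is m.+1 then rcons (u m) (f (u m)) else [::].
pose x : cantor_space := fun n => f (u n).
have ux n : restr x n = u n by elim: n => [//|n IH]; rewrite restrS IH.
have [n] := hP x; rewrite ux => Pn.
suff : ~ good (u n) by apply; exists 0 => t _; apply: Pmono.
by elim: {Pn} n => [//|n IH] /=; apply: hf.
Qed.

(** * Measure of closed sets *)

Lemma half_exp_le m n : (m <= n)%N -> (2^-1 : Real) ^+ n <= 2^-1 ^+ m.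
Proof. by move=> mn; apply: ler_wiXn2l => //; rewrite ?invr_ge0 ?invf_le1 ?ler1n. Qed.

Lemma half_exp_lt (e : Real) : 0 < e -> exists n, (2^-1 : Real) ^+ n < e.
Proof.
move=> e0; have := @cvg_expr Real 2^-1; rewrite ger0_norm// => /(_ ltac:(lra)).
move=> /cvgrPdist_lt /(_ e e0) [N _ /(_ N (leqnn N))].
by rewrite /= sub0r normrN ger0_norm ?exprn_ge0// => h; exists N.
Qed.

(* For the tree [tau] of a closed set, [rho tau n s] is the proportion of the
   extensions of [s] by [n] bits which are in [tau]; it decreases to the relative
   measure [relmu tau s] of the set in the cylinder of [s]. *)
Fixpoint rho (tau : seq bool -> bool) n s : Real :=
  if n is n'.+1 then (rho tau n' (rcons s false) + rho tau n' (rcons s true)) / 2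
  else (tau s)%:R.

Definition relmu (tau : seq bool -> bool) s : Real := limn (fun n => rho tau n s).

Definition downward (tau : seq bool -> bool) :=
  forall s b, tau (rcons s b) -> tau s.

Lemma rho_ge0 tau n s : 0 <= rho tau n s.
Proof. by elim: n s => [|n IH] s /=; [exact: ler0n|have := IH (rcons s false); have := IH (rcons s true); lra]. Qed.

Lemma rho_le1 tau n s : rho tau n s <= 1.
Proof.
elim: n s => [|n IH] s /=; first by case: (tau s).
by have := IH (rcons s false); have := IH (rcons s true); lra.
Qed.

Lemma rho_decr tau : downward tau ->
  forall s, nonincreasing_seq (fun n => rho tau n s).
Proof.
move=> dt s; apply/nonincreasing_seqP => n; elim: n s => [|n IH] s /=.
  have := dt s true; have := dt s false.
  case: (tau (rcons s false)); case: (tau (rcons s true)); case: (tau s) => //= h1 h2;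
    rewrite ?(h1 isT) ?(h2 isT); try (by have := h1 isT); try (by have := h2 isT); lra.
have := IH (rcons s false); have := IH (rcons s true) => /=; lra.
Qed.

Lemma rho_cvg tau s : downward tau -> cvgn (fun n => rho tau n s).
Proof.
move=> dt; apply: nonincreasing_is_cvgn; first exact: rho_decr.
by exists 0 => _ [n _ <-]; exact: rho_ge0.
Qed.

Lemma relmu_le_rho tau n s : downward tau -> relmu tau s <= rho tau n s.
Proof.
by move=> dt; apply: nonincreasing_cvgn_ge; [exact: rho_decr|exact: rho_cvg].
Qed.

Lemma relmu_lt tau s q : downward tau ->
  relmu tau s < q <-> exists n, rho tau n s < q.
Proof.
move=> dt; split; last by move=> [n]; apply: le_lt_trans; exact: relmu_le_rho.
move=> lq; apply: contrapT => /forallNP h.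
have : q <= relmu tau s.
  apply: limr_ge; first exact: rho_cvg.
  by near=> n; rewrite leNgt; apply/negP/h.
by rewrite leNgt lq.
Unshelve. all: by end_near. Qed.

Lemma relmu_ge0 tau s : downward tau -> 0 <= relmu tau s.
Proof.
move=> dt; apply: limr_ge; first exact: rho_cvg.
by near=> n; exact: rho_ge0.
Unshelve. all: by end_near. Qed.

Lemma relmu_le1 tau s : downward tau -> relmu tau s <= 1.
Proof. by move=> dt; apply: le_trans (relmu_le_rho 0 s dt) (rho_le1 _ _ _). Qed.

Lemma relmu_split tau s : downward tau ->
  relmu tau s = (relmu tau (rcons s false) + relmu tau (rcons s true)) / 2.
Proof.
move=> dt; have c t : cvgn (fun n => rho tau n t) by exact: rho_cvg.
have -> : relmu tau s = limn (fun n => rho tau n.+1 s).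
  by apply/esym/cvg_lim => //; rewrite (cvg_shiftS (fun n => rho tau n s)); exact: c.
apply/cvg_lim => //=; apply: cvgMl; apply: cvgD; exact: c.
Qed.

Lemma rho_shift tau s t n :
  rho tau n (s ++ t) = rho (fun u => tau (s ++ u)) n t.
Proof. by elim: n t => [//|n IH] t /=; rewrite !rcons_cat !IH. Qed.

Lemma relmu_shift tau s t : relmu tau (s ++ t) = relmu (fun u => tau (s ++ u)) t.
Proof. by congr (limn _); apply/funext => n; exact: rho_shift. Qed.

Lemma rho_const tau n s b : (forall t, tau (s ++ t) = b) -> rho tau n s = b%:R.
Proof.
elim: n s => [|n IH] s h /=; first by rewrite -[s]cats0 h.
by rewrite !IH => [|t|t]; rewrite ?cat_rcons ?h//; lra.
Qed.

Lemma relmu_const tau s b : (forall t, tau (s ++ t) = b) -> relmu tau s = b%:R.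
Proof.
move=> h; rewrite /relmu (_ : (fun n => _) = fun=> b%:R) ?lim_cst//.
by apply/funext => n; exact: rho_const.
Qed.

Definition tree (A : set cantor_space) (s : seq bool) : bool :=
  `[< A `&` cyl s !=set0 >].

Lemma downward_tree A : downward (tree A).
Proof.
by move=> s b /asboolP[y [Ay /cyl_rcons ys]]; apply/asboolP; exists y.
Qed.

Lemma tree_rcons A s : tree A s = tree A (rcons s false) || tree A (rcons s true).
Proof.
apply/idP/orP; last by case; exact: downward_tree.
move=> /asboolP[y [Ay /cyl_rconsP]].
by case: (y (size s)) => yc; [right|left]; apply/asboolP; exists y.
Qed.

Fixpoint leaves (tau : seq bool -> bool) n s : seq (seq bool) :=
  if n is n'.+1 then leaves tau n' (rcons s false) ++ leaves tau n' (rcons s true)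
  else if tau s then [:: s] else [::].

Lemma sum_leaves tau n s :
  \sum_(t <- leaves tau n s) (2^-1 : Real) ^+ size t =
  2^-1 ^+ size s * rho tau n s.
Proof.
elim: n s => [|n IH] s /=.
  by case: (tau s); rewrite ?big_seq1 ?big_nil ?mulr1 ?mulr0.
rewrite big_cat/= !IH !size_rcons exprS; lra.
Qed.

Lemma leaves_cover A n s :
  A `&` cyl s `<=` [set y | exists2 t, t \in leaves (tree A) n s & cyl t y].
Proof.
elim: n s => [|n IH] s y [Ay ys] /=.
  rewrite (_ : tree A s = true); first by exists s; rewrite ?mem_seq1.
  by apply/asboolP; exists y.
have := cyl_rconsP ys; case: (y (size s)) => h.
  by have [t tl ty] := IH (rcons s true) y (conj Ay h); exists t; rewrite // mem_cat tl orbT.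
by have [t tl ty] := IH (rcons s false) y (conj Ay h); exists t; rewrite // mem_cat tl.
Qed.

Lemma mu_le_list (l : seq (seq bool)) A :
  A `<=` [set y | exists2 t, t \in l & cyl t y] ->
  (mu A <= (\sum_(t <- l) 2^-1 ^+ size t)%:E)%E.
Proof.
move=> hA; apply/lee_addgt0Pr => e e0.
have [N hN] := half_exp_lt e0.
(* [mu] uses infinite covers: past the end of [l] come strings of lengths N+1, N+2, ..., of total
   weight at most 2^-N < e. *)
pose c k := if (k < size l)%N then nth [::] l k else nseq (N + (k - size l).+1) true.
apply: ge_ereal_inf; exists (\sum_(k <oo) (2^-1 ^+ size (c k))%:E)%E.
  exists c => // y /hA [t tl ty]; exists (index t l) => //.
  by rewrite /c index_mem tl nth_index.
have c0 k : (0 <= (2^-1 ^+ size (c k) : Real)%:E)%E by rewrite lee_fin exprn_ge0.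
apply: lime_le; first by apply: is_cvg_nneseries.
exists (size l) => // n /= sn.
rewrite (big_cat_nat _ sn) //= !sumEFin -!EFinD lee_fin.
apply: lerD.
  rewrite (big_nth [::]) !big_mkord.
  by rewrite le_eqVlt; apply/orP; left; apply/eqP/eq_bigr => i _; rewrite /c ltn_ord.
apply: le_trans (ltW hN); set m := (n - size l)%N.
rewrite -{1}[size l]add0n big_addn -/m.
have : \sum_(0 <= i < m) (2^-1 : Real) ^+ size (c (i + size l)%N) <= 2^-1 ^+ N * (1 - 2^-1 ^+ m).
  elim: m => [|m IH]; first by rewrite big_geq// expr0 subrr mulr0.
  rewrite big_nat_recr//= /c ltnNge leq_addl/= size_nseq addnK exprD exprS in IH *.
  have : 0 <= (2^-1 : Real) ^+ N by rewrite exprn_ge0.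
  move: IH; lra.
move/le_trans; apply; rewrite ler_piMr ?exprn_ge0// gerBl exprn_ge0//.
Qed.

Lemma mu_le A n s : (mu (A `&` cyl s) <= (2^-1 ^+ size s * rho (tree A) n s)%:E)%E.
Proof. by rewrite -sum_leaves; apply: mu_le_list; exact: leaves_cover. Qed.

Lemma rho_sum (tau : seq bool -> bool) (c : nat -> seq bool) K n s :
  (forall t, size t = n -> tau (s ++ t) ->
     exists2 k, (k < K)%N & prefix (c k) (s ++ t)) ->
  rho tau n s <= \sum_(k < K) rho (prefix (c k)) n s.
Proof.
elim: n s => [|n IH] s h /=.
  have := h [::] erefl; rewrite cats0; case: (tau s) => [[]// k kK ck|_].
    by rewrite (bigD1 (Ordinal kK))//= ck lerDl sumr_ge0.
  by rewrite sumr_ge0.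
rewrite -mulr_suml big_split/= ler_pM2r; last lra.
by apply: lerD; apply: IH => t st; rewrite cat_rcons; apply: h; rewrite /= st.
Qed.

Lemma rho_prefix_le c n s :
  2^-1 ^+ size s * rho (prefix c) n s <= 2^-1 ^+ size c.
Proof.
elim: n s => [|n IH] s /=.
  have [cs|_] := boolP (prefix c s); last by rewrite mulr0 exprn_ge0.
  by rewrite mulr1; exact/half_exp_le/size_prefix.
have [cs|sc] := leqP (size c) (size s).
  apply: (@le_trans _ _ (2^-1 ^+ size s)).
    by rewrite ler_piMr ?exprn_ge0//; exact: (rho_le1 (prefix c) n.+1 s).
  exact: half_exp_le.
have z b : b != nth false c (size s) -> rho (prefix c) n (rcons s b) = 0.
  move=> h; apply: (@rho_const _ _ _ false) => t.
  apply/negP => /prefixP[u /(congr1 (fun w => nth false w (size s)))].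
  rewrite nth_cat size_rcons leqnn nth_rcons ltnn eqxx nth_cat sc.
  by move=> e; rewrite e eqxx in h.
have := IH (rcons s false); have := IH (rcons s true); rewrite !size_rcons exprS.
by case: (nth false c (size s)) z => z; [rewrite (z false)//|rewrite (z true)//]; lra.
Qed.

(** By compactness finitely many members of a cover suffice, and they are recognized at a common
    level [n]. There the union bound [rho_sum] is a finite count. *)
Lemma mu_ge A s : closed A ->
  ((2^-1 ^+ size s * relmu (tree A) s)%:E <= mu (A `&` cyl s))%E.
Proof.
move=> cA; apply: le_ereal_inf_tmp => _ [c hc <-].
pose P t := tree A (s ++ t) -> exists k, prefix (c k) (s ++ t).
have [||n hn] := @fan P.
- rewrite /P => t u h; rewrite catA => h'.
  case: h; last by move=> k hk; exists k; apply: prefix_catl.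
  by case/asboolP: h' => y [Ay yy]; apply/asboolP; exists y; split=> //; apply: cyl_cat yy.
- move=> x; have ys := @cyl_app s x; set y := app s x in ys.
  have [Ay|nAy] := pselect (A y).
    have [k _ yk] := hc y (conj Ay ys); exists (size (c k)) => _; exists k.
    rewrite -restr_app -(cat_take_drop (size (c k)) (restr _ _)) take_restr ?leq_addl//.
    by rewrite ((cylP _ _).1 yk) prefix_prefix.
  have [n hn] := closed_avoid cA nAy; exists n.
  rewrite /P -restr_app => /asboolP[z [Az yz]]; exfalso; apply: (hn z Az).
  apply/cyl_restr => i ilt; move/cyl_restr: yz; apply; exact: ltn_addl.
have [K hK] : exists K, forall t, size t = n -> tree A (s ++ t) ->
    exists2 k, (k < K)%N & prefix (c k) (s ++ t).
  have [|K hK] := @choice _ _ (fun (t : n.-tuple bool) k => tree A (s ++ t) -> prefix (c k) (s ++ t)).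
    move=> t; case: (pselect (tree A (s ++ t))) => [h|h]; last by exists 0%N.
    by have [k hk] := hn t (size_tuple t) h; exists k.
  exists (\max_t K t).+1 => t st ht.
  move/eqP: st => st; exists (K (Tuple st)); last exact: hK (Tuple st) ht.
  by rewrite ltnS (@leq_bigmax _ (fun t => K t)).
apply: (@le_trans _ _ (\sum_(0 <= k < K) (2^-1 ^+ size (c k))%:E)%E).
  rewrite sumEFin lee_fin big_mkord.
  apply: (@le_trans _ _ (2^-1 ^+ size s * \sum_(k < K) rho (prefix (c k)) n s)).
    rewrite ler_wpM2l ?exprn_ge0//.
    apply: le_trans (relmu_le_rho n s (@downward_tree A)) _; exact: rho_sum.
  by rewrite mulr_sumr; apply: ler_sum => k _; exact: rho_prefix_le.
by apply: nneseries_lim_ge => k _ _; rewrite lee_fin exprn_ge0.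
Qed.

Lemma mu_closed A s : closed A ->
  mu (A `&` cyl s) = (2^-1 ^+ size s * relmu (tree A) s)%:E.
Proof.
move=> cA; apply/le_anti; rewrite mu_ge// andbT.
apply/lee_addgt0Pr => e e0.
have /(relmu_lt _ _ (@downward_tree A))[n hn] : relmu (tree A) s < relmu (tree A) s + e.
  by rewrite ltrDl.
apply: le_trans (mu_le A n s) _; rewrite -EFinD lee_fin.
have := half_exp_le (leq0n (size s)); have : 0 <= (2^-1 : Real) ^+ size s by rewrite exprn_ge0.
by move: hn; set r := rho _ _ _; set r' := relmu _ _; set h := _ ^+ _; rewrite expr0; nra.
Qed.

Lemma mu_cyl s : mu (cyl s) = (2^-1 ^+ size s)%:E.
Proof.
rewrite -[cyl s]setTI mu_closed; last exact: closedT.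
rewrite (@relmu_const _ _ true) ?mulr1// => t; apply/asboolP.
by exists (fun i => nth false (s ++ t) i); split.
Qed.

Lemma density_ratioE A z n : closed A ->
  density_ratio A z n = relmu (tree A) (restr z n).
Proof.
move=> cA; rewrite /density_ratio mu_closed// mu_cyl/= mulrC mulKf// expf_neq0.
Qed.

(** * Restriction to a cylinder, and clopen sets of dyadic measure *)

Definition tail n (y : cantor_space) : cantor_space := fun i => y (n + i)%N.

Definition localize (s : seq bool) (A : set cantor_space) : set cantor_space :=
  [set y | A (app s y)].

Lemma app_tail s y : cyl s y -> app s (tail (size s) y) = y.
Proof.
move=> h; apply/funext => i; rewrite /app /tail; case: ltnP => [|/subnKC->//].
by move=> /h.
Qed.

Lemma tail_app s y : tail (size s) (app s y) = y.
Proof. by apply/funext => i; rewrite /tail /app ltnNge leq_addr/= addKn. Qed.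

Lemma cyl_cat_app s t y : cyl (s ++ t) (app s y) <-> cyl t y.
Proof.
split=> h i ilt.
  have := h (size s + i)%N; rewrite size_cat ltn_add2l => /(_ ilt).
  by rewrite /app nth_cat ltnNge leq_addr/= addKn.
rewrite /app nth_cat; case: ltnP => // si; apply: h.
by rewrite size_cat in ilt; rewrite ltn_subLR.
Qed.

Lemma tree_localize A s t : tree A (s ++ t) = tree (localize s A) t.
Proof.
apply/asboolP/asboolP => -[y [Ay yc]].
  have e := app_tail (cyl_cat yc).
  exists (tail (size s) y); split; first by rewrite /localize/= e.
  by apply/(@cyl_cat_app s); rewrite e.
by exists (app s y); split=> //; apply/cyl_cat_app.
Qed.

Lemma relmu_localize A s : relmu (tree A) s = relmu (tree (localize s A)) [::].
Proof.
by rewrite -{1}[s]cats0 relmu_shift; congr relmu; apply/funext => t; exact: tree_localize.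
Qed.

(** Clopenness with an explicit modulus; the bound [l] later tells from which level on the relative
    measures are constant. *)
Definition dependsOn (l : nat) (D : set cantor_space) :=
  forall y y' : cantor_space, (forall i, (i < l)%N -> y i = y' i) -> D y -> D y'.

Lemma relmu_set0 s : relmu (tree set0) s = 0.
Proof. by rewrite (@relmu_const _ _ false)// => t; apply/asboolP => -[y []]. Qed.

Lemma relmu_setT s : relmu (tree setT) s = 1.
Proof.
rewrite (@relmu_const _ _ true)// => t; apply/asboolP.
by exists (fun i => nth false (s ++ t) i); split.
Qed.

(** Bisection on the first bit: for a small [a] the half with first bit [true] is left empty, for a
    large one the half with first bit [false] is taken whole, and the other half is filled
    recursively. *)
Lemma clopen_of_dyadic n a : (a <= 2 ^ n)%N ->
  exists D, (exists l, dependsOn l D) /\ relmu (tree D) [::] = a%:R / 2 ^+ n.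
Proof.
have split01 (D : set cantor_space) b : localize [:: b] (fun y : cantor_space => if y 0%N then D (tail 1 y) else setT y) = if b then D else setT.
  by apply/funext => y; rewrite /localize/app/=; case: b => //; congr D; apply/funext => i; rewrite /tail/= subn1.
have split10 (D : set cantor_space) b : localize [:: b] (fun y : cantor_space => if y 0%N then set0 y else D (tail 1 y)) = if b then set0 else D.
  by apply/funext => y; rewrite /localize/app/=; case: b => //; congr D; apply/funext => i; rewrite /tail/= subn1.
elim: n a => [|n IH] a ha.
  case: a ha => [_|[_|//]].
    by exists set0; split; [exists 0%N|rewrite relmu_set0 mul0r].
  by exists setT; split; [exists 0%N|rewrite relmu_setT expr0 divr1].
have [a2|a2] := leqP a (2 ^ n).
  have [D [[l hl] hD]] := IH _ a2.
  exists (fun y : cantor_space => if y 0%N then set0 y else D (tail 1 y)); split.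
    exists l.+1 => y y' e; rewrite -(e 0%N)//; case: (y 0%N) => //; apply: hl => i il.
    exact: e.
  rewrite relmu_split; last exact: downward_tree.
  rewrite relmu_localize [in X in _ + X]relmu_localize !split10 relmu_set0 hD exprS addr0 invfM.
  by rewrite mulrCA mulrC.
have a3 : (a - 2 ^ n <= 2 ^ n)%N by rewrite leq_subLR addnn -mul2n -expnS.
have [D [[l hl] hD]] := IH _ a3.
exists (fun y : cantor_space => if y 0%N then D (tail 1 y) else setT y); split.
  exists l.+1 => y y' e; rewrite -(e 0%N)//; case: (y 0%N) => //; apply: hl => i il.
  exact: e.
rewrite relmu_split; last exact: downward_tree.
rewrite relmu_localize [in X in _ + X]relmu_localize !split01 relmu_setT hD natrB ?(ltnW a2)// natrX exprS.
by field; rewrite ?expf_neq0.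
Qed.

Definition dyadic (r : Real) := exists n (z : int), r = z%:~R / 2 ^+ n.

Lemma dyadicB r s : dyadic r -> dyadic s -> dyadic (r - s).
Proof.
move=> [n [z ->]] [m [w ->]]; exists (n + m)%N, (z * 2 ^+ m - w * 2 ^+ n).
rewrite rmorphB !rmorphM !rmorphXn/= exprD; field; apply/andP; split; rewrite expf_neq0// pnatr_eq0.
Qed.

Lemma dyadicN r : dyadic r -> dyadic (- r).
Proof. by rewrite -sub0r; apply: dyadicB; exists 0, 0; rewrite mul0r. Qed.

Lemma dyadicD r s : dyadic r -> dyadic s -> dyadic (r + s).
Proof. by rewrite -[s in r + s]opprK => ? /dyadicN; exact: dyadicB. Qed.

Lemma clopen_of_measure r : dyadic r -> 0 <= r <= 1 ->
  exists D, (exists l, dependsOn l D) /\ relmu (tree D) [::] = r.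
Proof.
move=> [n [z rE]] /andP[r0 r1].
have p0 : (0 : Real) < 2 ^+ n by rewrite exprn_gt0.
have z0 : 0 <= z.
  by move: r0; rewrite rE pmulr_lge0 ?invr_gt0// ler0z.
case: z z0 rE => // a _ rE; rewrite rE; apply: clopen_of_dyadic.
by move: r1; rewrite rE ler_pdivrMr// mul1r -natrX -[_%:~R]/(a%:R) ler_nat.
Qed.

(* Meaningful for dyadic [r] between 0 and 1 only, see [fillP]. *)
Definition fill (r : Real) : set cantor_space :=
  xget set0 [set D | (exists l, dependsOn l D) /\ relmu (tree D) [::] = r].

Lemma fillP r : dyadic r -> 0 <= r <= 1 ->
  (exists l, dependsOn l (fill r)) /\ relmu (tree (fill r)) [::] = r.
Proof.
move=> dr /(clopen_of_measure dr) ex.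
exact: (@xgetPex _ set0 [set D | (exists l, dependsOn l D) /\ relmu (tree D) [::] = r] ex).
Qed.

Lemma fill_nonempty r : dyadic r -> 0 < r <= 1 -> fill r !=set0.
Proof.
move=> dr /andP[r0 r1]; apply/set0P/eqP => e; have [] := @fillP r dr.
  by rewrite ltW.
by rewrite e relmu_set0 => _ h; rewrite -h ltxx in r0.
Qed.

(** Beyond [l] bits past [p] membership in [A] is decided, so the ratio is frozen. Off the spine
    this gives density 0 or 1. *)
Lemma relmu_clopen A p l y : dependsOn l (localize p A) -> cyl p y ->
  forall n, (size p + l <= n)%N -> relmu (tree A) (restr y n) = (`[< A y >])%:R.
Proof.
move=> hl py n hn; apply: relmu_const => t.
have key z : cyl (restr y n ++ t) z -> A z <-> A y.
  move=> /cyl_cat/cyl_restr yz.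
  have pz : cyl p z.
    by move=> i ilt; rewrite yz ?py//; apply: leq_trans ilt _; apply: leq_trans hn; exact: leq_addr.
  have := hl (tail (size p) y) (tail (size p) z); have := hl (tail (size p) z) (tail (size p) y).
  rewrite /localize/= (app_tail py) (app_tail pz) => h1 h2.
  by split; [apply: h1|apply: h2] => i il; rewrite /tail yz// (leq_trans _ hn)// ltn_add2l.
case: asboolP => yA.
  apply/asboolP; exists (fun i => nth false (restr y n ++ t) i); split=> //.
  exact/key.
by apply/asboolP => -[z [Az /key h]]; apply/yA/h.
Qed.

(** * Compact sets with prescribed densities *)

Definition unspread (y : cantor_space) : cantor_space := fun i => y i.*2.+1.
Definition spread (x : cantor_space) : cantor_space :=
  fun i => if odd i then x i./2 else false.
Definition spreads (s : seq bool) : seq bool := restr (spread (nth false s)) (size s).*2.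

Lemma restr_nth s : restr (nth false s) (size s) = s.
Proof. exact: mkseq_nth. Qed.

Lemma spreadK x : unspread (spread x) = x.
Proof. by apply/funext => i; rewrite /unspread /spread oddS odd_double/= uphalf_double. Qed.

Lemma size_spreads s : size (spreads s) = (size s).*2.
Proof. exact: size_restr. Qed.

Lemma spreads_restr x n : spreads (restr x n) = restr (spread x) n.*2.
Proof.
rewrite /spreads size_restr; apply: restr_eq => i ilt; rewrite /spread.
by case: odd => //; rewrite nth_mkseq// ltn_half_double.
Qed.

Lemma spreads_rcons s b : spreads (rcons s b) = spreads s ++ [:: false; b].
Proof.
have e : rcons s b = restr (nth false (rcons s b)) (size s).+1.
  by rewrite -(size_rcons s b) restr_nth.
rewrite e; set w := nth false (rcons s b); rewrite spreads_restr doubleS !restrS -!cats1 -catA/=; congr (_ ++ [:: _; _]).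
- apply: restr_eq => i ilt; rewrite /spread; case: odd => //.
  by rewrite /w nth_rcons ltn_half_double ilt.
- by rewrite /spread odd_double.
- by rewrite /spread oddS odd_double/= uphalf_double /w nth_rcons ltnn eqxx.
Qed.

Lemma nth_spreads_even s j : (j < size s)%N -> nth false (spreads s) j.*2 = false.
Proof. by move=> h; rewrite nth_mkseq ?ltn_double// /spread odd_double. Qed.

Lemma nth_spreads_odd s j : (j < size s)%N -> nth false (spreads s) j.*2.+1 = nth false s j.
Proof.
move=> h; rewrite nth_mkseq ?ltn_Sdouble// /spread oddS odd_double/=.
by rewrite uphalf_double.
Qed.

Lemma app_cat s t y : app (s ++ t) y = app s (app t y).
Proof.
apply/funext => i; rewrite /app size_cat nth_cat; case: (ltnP i (size s)) => [ilt|sl].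
  by rewrite ltn_addr.
by rewrite ltn_subLR// subnDA.
Qed.

Lemma restr_unspread_app s y j : (j <= size s)%N -> restr (unspread (app (spreads s) y)) j = take j s.
Proof.
move=> js; rewrite -[s in RHS]restr_nth -[in RHS](subnKC js) /restr /mkseq iotaD map_cat.
rewrite take_size_cat ?size_map ?size_iota//; apply: restr_eq => i ilt.
have ils := leq_trans ilt js.
by rewrite /unspread /app size_spreads ltn_Sdouble ils nth_spreads_odd.
Qed.

Section gadget.
Context (S : seq bool -> Prop) (v : seq bool -> Real).

(* [mval s] is the relative measure to be achieved in the cylinder of [spreads s],
   and [v s] the one in the cylinder of [spreads s ++ [:: false]]; [exitval s] is
   what the cylinder of [spreads s ++ [:: true]] has to contribute. *)
Definition mval (s : seq bool) : Real :=
  if s is b :: s' then v (belast b s') else 2^-1.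

Definition exitval s := 2 * mval s - v s.

Definition alive (y : cantor_space) i :=
  forall j, (j < i)%N -> y j.*2 = false /\ S (restr (unspread y) j).

(** There are two ways to leave the spine at level [i]: the string read so far is outside [S], or
    the bit at 2i is true. A point which never leaves meets all conditions, so it belongs to the
    set. *)
Definition gadget_cond (y : cantor_space) i := alive y i ->
  (~ S (restr (unspread y) i) -> fill (mval (restr (unspread y) i)) (tail i.*2 y)) /\
  (S (restr (unspread y) i) -> y i.*2 ->
     fill (exitval (restr (unspread y) i)) (tail i.*2.+1 y)).

Definition gadget : set cantor_space := [set y | forall i, gadget_cond y i].

Definition reached s := forall j, (j < size s)%N -> S (take j s).

Lemma mval_rcons s b : mval (rcons s b) = v s.
Proof. by case: s => [|a s] //=; rewrite belast_rcons. Qed.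

Lemma reached_rcons s b : reached s -> S s -> reached (rcons s b).
Proof.
move=> rs Ss j; rewrite size_rcons ltnS => js; rewrite -cats1 takel_cat//.
move: js; rewrite leq_eqVlt => /orP[/eqP->|/rs//]; by rewrite take_size.
Qed.

Lemma alive_app s y i : reached s -> (i <= size s)%N -> alive (app (spreads s) y) i.
Proof.
move=> rs ils j ji; have js := leq_trans ji ils.
rewrite restr_unspread_app; last exact: ltnW; split; last exact: rs.
by rewrite /app size_spreads ltn_double js nth_spreads_even.
Qed.

Lemma gadget_cond_before s y i : reached s -> (i < size s)%N ->
  gadget_cond (app (spreads s) y) i.
Proof.
move=> rs ils _; rewrite restr_unspread_app; last exact: ltnW.
split=> [/(_ (rs _ ils))//|_].
by rewrite /app size_spreads ltn_double ils nth_spreads_even.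
Qed.

Lemma localize_dead s : reached s -> ~ S s -> localize (spreads s) gadget = fill (mval s).
Proof.
move=> rs nSs; apply/seteqP; split=> y.
  move=> /(_ (size s)) []; first exact: alive_app.
  rewrite restr_unspread_app// take_size => /(_ nSs) + _.
  by rewrite -size_spreads tail_app.
move=> fy i; case: (ltngtP i (size s)) => [|sl /(_ _ sl)|->].
- exact: gadget_cond_before.
- by rewrite restr_unspread_app// take_size => -[].
- by rewrite /gadget_cond restr_unspread_app// take_size -size_spreads tail_app.
Qed.

Lemma localize_exit s : reached s -> S s ->
  localize (spreads s ++ [:: true]) gadget = fill (exitval s).
Proof.
move=> rs Ss.
have ye y : app (spreads s ++ [:: true]) y (size s).*2 = true.
  by rewrite /app size_cat size_spreads addn1 leqnn nth_cat size_spreads ltnn subnn.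
have te y : tail (size s).*2.+1 (app (spreads s ++ [:: true]) y) = y.
  by rewrite -size_spreads -addn1 -(size_cat _ [:: true]) tail_app.
apply/seteqP; split=> y.
  move=> /(_ (size s)); rewrite /gadget_cond te ye app_cat restr_unspread_app// take_size.
  by case=> [|_]; [exact: alive_app|apply].
move=> fy i; case: (ltngtP i (size s)) => [||->].
- by rewrite app_cat; exact: gadget_cond_before.
- by move=> sl /(_ _ sl); rewrite ye => -[].
- by rewrite /gadget_cond te ye app_cat restr_unspread_app// take_size.
Qed.

Context (hv : forall s, dyadic (v s) /\ 3/8 <= v s <= 5/8).

Lemma mval_bounds s : dyadic (mval s) /\ 3/8 <= mval s <= 5/8.
Proof.
case: s => [|b s] /=; last exact: hv.
by split; [exists 1%N, 1; rewrite mul1r|lra].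
Qed.

(** Here the interval [3/8, 5/8] pays off: 2 * 3/8 - 5/8 = 1/8 and 2 * 5/8 - 3/8 = 7/8, so the
    compensation is the measure of a nonempty clopen set. *)
Lemma exitval_bounds s : dyadic (exitval s) /\ 1/8 <= exitval s <= 7/8.
Proof.
have [dm bm] := mval_bounds s; have [dv bv] := hv s; split.
  by rewrite /exitval mulr_natl mulr2n; apply/dyadicB=> //; exact: dyadicD.
by rewrite /exitval; lra.
Qed.

Lemma relmu_gadget_split s : reached s -> S s ->
  relmu (tree gadget) (spreads s) =
    (relmu (tree gadget) (spreads s ++ [:: false]) + exitval s) / 2 /\
  relmu (tree gadget) (spreads s ++ [:: false]) =
    (relmu (tree gadget) (spreads (rcons s false)) + relmu (tree gadget) (spreads (rcons s true))) / 2.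
Proof.
move=> rs Ss; have [de be] := exitval_bounds s; split.
  rewrite relmu_split; last exact: downward_tree.
  rewrite -!cats1; congr ((_ + _) / _).
  rewrite relmu_localize localize_exit//; apply: (fillP de _).2; lra.
rewrite relmu_split; last exact: downward_tree.
by rewrite !spreads_rcons -!cats1 -!catA.
Qed.

(* The error satisfies [err s = (err (s0) + err (s1)) / 4] and is bounded. *)
Lemma relmu_spreads s : reached s -> relmu (tree gadget) (spreads s) = mval s.
Proof.
move=> rs; set r := relmu (tree gadget).
have approx n : forall s, reached s -> `|r (spreads s) - mval s| <= 2^-1 ^+ n.
  elim: n => [|n IH] {rs}s rs.
    have [_ /andP[m1 m2]] := mval_bounds s.
    have : 0 <= r (spreads s) by apply: relmu_ge0; exact: downward_tree.
    have : r (spreads s) <= 1 by apply: relmu_le1; exact: downward_tree.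
    by rewrite expr0 ler_norml; lra.
  have [Ss|nSs] := pselect (S s); last first.
    have [dm bm] := mval_bounds s.
    rewrite /r relmu_localize localize_dead// (fillP dm _).2; last lra.
    by rewrite subrr normr0 exprn_ge0.
  have [e1 e2] := relmu_gadget_split rs Ss.
  have := IH _ (@reached_rcons s false rs Ss); have := IH _ (@reached_rcons s true rs Ss).
  rewrite !mval_rcons exprS /r e1 e2 /exitval !ler_norml.
  by have : 0 <= (2^-1 : Real) ^+ n by [rewrite exprn_ge0]; lra.
apply/eqP; rewrite -subr_eq0 -normr_le0; apply/ler_addgt0Pr => e e0.
have [N h] := half_exp_lt e0.
by rewrite add0r; apply: le_trans (approx N s rs) (ltW h).
Qed.

Lemma relmu_spreads_false s : reached s -> S s ->
  relmu (tree gadget) (spreads s ++ [:: false]) = v s.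
Proof.
move=> rs Ss; have [_ ->] := relmu_gadget_split rs Ss.
rewrite !relmu_spreads ?mval_rcons; [lra| |]; exact: reached_rcons.
Qed.

(** Each [gadget_cond y i] is decided by finitely many bits of [y], because the sets [fill] involved
    are clopen. *)
Lemma gadget_closed : closed gadget.
Proof.
apply/closed_cantorP => x hx i ax.
have trans n (y : cantor_space) : cyl (restr x n) y -> forall j, (j < n)%N -> x j = y j.
  by move=> /cyl_restr h j jn; rewrite h.
have rd n (y : cantor_space) : cyl (restr x n) y -> (i.*2 <= n)%N ->
    forall j, (j <= i)%N -> restr (unspread y) j = restr (unspread x) j.
  move=> /trans h hn j ji; apply: restr_eq => k kj; rewrite /unspread h//.
  by rewrite (leq_trans _ hn)// ltn_Sdouble (leq_trans kj).
have al n (y : cantor_space) : cyl (restr x n) y -> (i.*2 <= n)%N -> alive y i.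
  move=> yn hn j ji; rewrite (rd _ _ yn hn) ?(ltnW ji)//.
  rewrite -(trans _ _ yn); first exact: ax.
  by rewrite (leq_trans _ hn)// ltn_double.
have [dm bm] := mval_bounds (restr (unspread x) i).
have [de be] := exitval_bounds (restr (unspread x) i).
split.
  move=> nS; have [|[l hl] _] := @fillP _ dm; first lra.
  have [y /(_ i) Ky yn] := hx (i.*2 + l)%N.
  have [] := Ky (al _ _ yn (leq_addr _ _)); rewrite (rd _ _ yn (leq_addr _ _))// => /(_ nS) h _.
  by apply: hl h => j jl; rewrite /tail (trans _ _ yn)// ltn_add2l.
move=> Sx xi; have [|[l hl] _] := @fillP _ de; first lra.
have [y /(_ i) Ky yn] := hx (i.*2.+1 + l)%N.
have le : (i.*2 <= i.*2.+1 + l)%N by rewrite addSn ltnW// ltnS leq_addr.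
have [] := Ky (al _ _ yn le); rewrite (rd _ _ yn le)// => _ /(_ Sx).
rewrite -(trans _ _ yn) ?addSn ?ltnS ?leq_addr// => /(_ xi) h.
by apply: hl h => j jl; rewrite /tail (trans _ _ yn)// ltn_add2l.
Qed.

End gadget.

Section gadget_density.
Context (S : seq bool -> Prop) (v : seq bool -> Real).
Context (hv : forall s, dyadic (v s) /\ 3/8 <= v s <= 5/8).
Let G := gadget S v.
Let cG : closed G := gadget_closed hv.

Definition spine (y : cantor_space) := forall j, y j.*2 = false /\ S (restr (unspread y) j).

Lemma alive_reached y i : alive S y i -> reached S (restr (unspread y) i).
Proof.
move=> ay j; rewrite size_restr => ji; rewrite take_restr; last exact: ltnW.
by have [] := ay _ ji.
Qed.

Lemma alive_spreads y i : alive S y i -> cyl (spreads (restr (unspread y) i)) y.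
Proof.
move=> ay; rewrite spreads_restr; apply/cyl_restr => j ji.
rewrite /spread; case oj: (odd j); rewrite -[in LHS](odd_double_half j) oj ?add1n ?add0n //.
by have [] := ay j./2; rewrite ?ltn_half_double.
Qed.

Lemma spine_spread y : spine y -> y = spread (unspread y).
Proof.
move=> sy; apply/funext => j; have /alive_spreads : alive S y j.+1 by move=> k _.
by rewrite spreads_restr => /cyl_restr/(_ j) -> //; rewrite doubleS ltnS -addnn ltnW// ltnS leq_addr.
Qed.

(** The first level where the spine condition fails puts [y] in a cylinder on which the set is a
    copy of some [fill]. *)
Lemma off_spine_ratio y : ~ spine y ->
  exists b : bool, \forall n \near \oo, density_ratio G y n = b%:R.
Proof.
move=> /existsNP ex.
pose P j := `[< ~ (y j.*2 = false /\ S (restr (unspread y) j)) >].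
have exP : exists j, P j by case: ex => j hj; exists j; exact/asboolP.
case: (ex_minnP exP) => j /asboolP nj jmin {exP ex}.
have ay : alive S y j.
  move=> i ij; apply: contrapT => h.
  by have := jmin i (introT (asboolP _) h); rewrite leqNgt ij.
have rs := alive_reached ay; have cs := alive_spreads ay.
set s := restr (unspread y) j in rs cs nj.
have [dm bm] := mval_bounds hv s; have [de be] := exitval_bounds hv s.
suff [p [l [hl py]]] : exists p l, dependsOn l (localize p G) /\ cyl p y.
  exists `[< G y >]; exists (size p + l)%N => // n /= hn.
  by rewrite density_ratioE// (relmu_clopen hl py).
have [Ss|nSs] := pselect (S s); last first.
  have [|[l hl] _] := @fillP _ dm; first lra.
  by exists (spreads s), l; rewrite /G localize_dead.
have [|[l hl] _] := @fillP _ de; first lra.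
exists (spreads s ++ [:: true]), l; rewrite /G localize_exit//; split=> //.
have yt : y j.*2 = true by case e: (y j.*2) => //; exfalso; apply: nj.
by have := cyl_rconsP cs; rewrite size_spreads size_restr yt -cats1.
Qed.

Lemma off_spine_limit y : ~ spine y -> exists2 b : bool,
  density_exists G y & density G y = b%:R.
Proof.
move=> /off_spine_ratio[b hb].
have c : density_ratio G y @ \oo --> (b%:R : Real).
  by apply: cvg_near_cst; exact: hb.
by exists b; [apply/cvg_ex; exists b%:R|exact: (cvg_lim (@Rhausdorff _) c)].
Qed.

(** Each value [v s] is seen at two consecutive levels: at [spreads s ++ [:: false]], and one bit
    later as [mval] of an extension of [s] by one bit. The shift by one skips the empty prefix,
    whose value is the initial 1/2. *)
Lemma spine_ratio y n : spine y -> density_ratio G y n.+1 = v (restr (unspread y) n./2).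
Proof.
move=> sy; have ay k : alive S y k by move=> j _.
rewrite density_ratioE// [in LHS](spine_spread sy) -{1}[n]odd_double_half.
case: (odd n) => /=; rewrite ?add0n ?add1n.
  by rewrite -doubleS -spreads_restr relmu_spreads// ?restrS ?mval_rcons// -restrS; exact: alive_reached.
rewrite restrS -spreads_restr -cats1 /spread odd_double relmu_spreads_false//; first exact: alive_reached.
exact: (sy _).2.
Qed.

Lemma spine_limit y l : spine y ->
  density_ratio G y @ \oo --> (l : Real) <-> (fun n => v (restr (unspread y) n)) @ \oo --> (l : Real).
Proof.
move=> sy; rewrite -(cvg_shiftS (density_ratio G y)).
have -> : [sequence density_ratio G y n.+1]_n = fun n => v (restr (unspread y) n./2).
  by apply/funext => n /=; rewrite spine_ratio.
split=> h.
  have h2 : (fun n : nat => n.*2) @ \oo --> \oo.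
    by move=> A [N _ NA]; exists N => // n /= Nn; apply: NA => /=; rewrite -addnn (leq_trans Nn)// leq_addr.
  have := cvg_comp _ _ h2 h.
  by rewrite (_ : _ \o _ = fun n => v (restr (unspread y) n))//; apply/funext => n /=; rewrite doubleK.
have h2 : (fun n : nat => n./2) @ \oo --> \oo.
  by move=> A [N _ NA]; exists N.*2 => // n /= Nn; apply: NA => /=; rewrite geq_half_double.
exact: (cvg_comp _ _ h2 h).
Qed.

Lemma spine_density_exists y : spine y ->
  density_exists G y <-> cvgn (fun n => v (restr (unspread y) n)).
Proof.
move=> sy; rewrite /density_exists; split=> /cvg_ex[l hl]; apply/cvg_ex; exists l.
  exact/spine_limit.
exact/(spine_limit l sy).
Qed.

Lemma spine_spreadP x : spine (spread x) <-> forall n, S (restr x n).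
Proof.
split=> [h n|h j]; first by have [_] := h n; rewrite spreadK.
by rewrite spreadK; split=> //; rewrite /spread odd_double.
Qed.

Lemma Sharp_gadget : Sharp G =
  spread @` [set x | (forall n, S (restr x n)) /\ cvgn (fun n => v (restr x n))].
Proof.
apply/seteqP; split=> [y [ey /andP[y0 y1]]|_ [x [Sx cx] <-]].
  have [sy|/off_spine_limit[b _ db]] := pselect (spine y); last first.
    by move: y0 y1; rewrite db; case: b {db}; rewrite ltxx.
  exists (unspread y); last by rewrite -spine_spread.
  by split; [move=> n; exact: (sy n).2|exact: (spine_density_exists sy).1 ey].
have sy : spine (spread x) by apply/spine_spreadP.
have := @spine_density_exists _ sy; rewrite spreadK => h; split; first exact/h.
have -> : density G (spread x) = limn (fun n => v (restr x n)).
  by apply/cvg_lim => //; apply/spine_limit => //; rewrite spreadK.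
apply/andP; split.
  apply: (@lt_le_trans _ _ (3/8)); first lra.
  by apply: limr_ge => //; apply: nearW => n; have [_ /andP[]] := hv (restr x n).
apply: (@le_lt_trans _ _ (5/8)); last lra.
by apply: limr_le => //; apply: nearW => n; have [_ /andP[]] := hv (restr x n).
Qed.

Lemma Blur_gadget : Blur G =
  spread @` [set x | (forall n, S (restr x n)) /\ ~ cvgn (fun n => v (restr x n))].
Proof.
apply/seteqP; split=> [y ny|_ [x [Sx cx] <-]].
  have [sy|/off_spine_limit[b /ny]//] := pselect (spine y).
  exists (unspread y); last by rewrite -spine_spread.
  split; first by move=> n; have [] := sy n.
  by move=> h; apply: ny; exact: (spine_density_exists sy).2 h.
have sy : spine (spread x) by apply/spine_spreadP.
by move/(spine_density_exists sy); rewrite spreadK.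
Qed.

End gadget_density.

(** Every [fill] in use is nonempty, so each exit is inhabited. Whether a string of length at most
    [n] is in the tree thus depends only on [S] up to length [n], which makes the reductions
    continuous. *)
Lemma gadget_tree_local S S' v n t :
  (forall s, dyadic (v s) /\ 3/8 <= v s <= 5/8) ->
  (forall s, (size s <= n)%N -> S s <-> S' s) -> (size t <= n)%N ->
  tree (gadget S v) t -> tree (gadget S' v) t.
Proof.
move=> hv SS tn /asboolP[y [Gy ty]].
have reached_iff s : (size s <= n.+1)%N -> reached S s -> reached S' s.
  move=> sn h j js; apply/SS; last exact: h.
  by rewrite size_takel ?(ltnW js)// -ltnS (leq_trans js).
(* A point that leaves the spine by level [n] is tested by [S] only on strings where [S] and [S']
   agree, so [y] itself serves. Otherwise it is replaced by a point that leaves right after the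
   prefix [s]. *)
have [ay|nay] := pselect (alive S y n.+1); last first.
  apply/asboolP; exists y; split=> // i ai; have iN : (i <= n)%N.
    rewrite leqNgt; apply/negP => ni; apply: nay => j jn.
    by have [? ?] := ai j (leq_trans jn ni); split=> //; apply/SS => //; rewrite size_restr.
  have SSi : S (restr (unspread y) i) <-> S' (restr (unspread y) i).
    by apply: SS; rewrite size_restr.
  have : alive S y i.
    move=> j ji; have [? ?] := ai j ji; split=> //; apply/SS => //.
    by rewrite size_restr ltnW// (leq_trans ji).
  move=> /Gy[h1 h2]; split; first by move=> nS; apply: h1 => /SSi.
  by move=> /SSi; exact: h2.
set s := restr (unspread y) n.+1.
have rs : reached S' s.
  by apply: (reached_iff s); rewrite ?size_restr//; exact: alive_reached.
have yc := alive_spreads ay.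
have tc z : cyl (spreads s) z -> cyl t z.
  move=> zc i it; rewrite -ty// zc ?yc// size_spreads size_restr; lia.
have [dm bm] := mval_bounds hv s; have [de be] := exitval_bounds hv s.
have [Ss|nSs] := pselect (S' s).
  have [|z hz] := @fill_nonempty _ de; first lra.
  apply/asboolP; exists (app (spreads s ++ [:: true]) z); split.
    by move: hz; rewrite -(localize_exit v rs Ss).
  by apply: tc; apply: cyl_cat (@cyl_app _ _).
have [|z hz] := @fill_nonempty _ dm; first lra.
apply/asboolP; exists (app (spreads s) z); split; last exact/tc/cyl_app.
by move: hz; rewrite -(localize_dead v rs nSs).
Qed.

(** * The Vietoris topology in terms of trees *)

Definition same_tree n (K K' : compK) :=
  forall t, (size t <= n)%N -> tree (Kset K') t = tree (Kset K) t.

(** It is enough to treat subbasic sets: meeting an open set is witnessed by one cylinder, and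
    inclusion in an open set is visible at a uniform level by [fan]. *)
Lemma nbhs_compK (K : compK) (U : set compK) : nbhs K U ->
  exists n, forall K', same_tree n K K' -> U K'.
Proof.
rewrite nbhsE => -[B [oB BK] BU].
pose F := filter_from [set: nat] (fun n => same_tree n K).
have FF : Filter F.
  apply: filter_from_filter; first by exists 0%N.
  move=> i j _ _; exists (maxn i j) => // K' h; split=> t ht; apply: h.
    by rewrite leq_max ht.
  by rewrite leq_max ht orbT.
suff [n _ hn] : F B by exists n => K' /hn/BU.
case: oB BK => D hD <- [A DA]; have [I hI AI] := hD _ DA => hK.
suff : F A by apply: filterS => K' hK'; exists A.
rewrite -AI in hK *; apply: (@filter_bigI _ _ I _ F) => -[b V] pI.
have : vietoris_subbase (b, V) K := hK _ pI.
have /set_mem oU : (b, V) \in [set p : bool * set cantor_space | open p.2] := hI _ pI.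
move: oU; rewrite /= => oU.
change (vietoris_subbase (b, V) K -> F [set K' | vietoris_subbase (b, V) K']).
rewrite /vietoris_subbase/=; case: b {pI} => /=.
  move=> KU.
  have [||n hn] := @fan (fun s => tree (Kset K) s -> cyl s `<=` V).
  - by move=> s t h tst; apply: subset_trans (@cyl_cat _ _) (h _); case/asboolP: tst => y [? /cyl_cat ?]; apply/asboolP; exists y.
  - move=> x; have [Kx|nKx] := pselect (Kset K x).
      by have [n nU] := (open_cantorP V).1 oU _ (KU _ Kx); exists n.
    have cK : closed (Kset K) by exact/compact_cantorP/Kset_compact.
    have [n hn] := closed_avoid cK nKx.
    by exists n => /asboolP[y [/hn]].
  exists n => // K' hK' y Ky.
  apply: (hn (restr y n)); rewrite ?size_restr//; last exact: cyl_restr_self.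
  rewrite -hK' ?size_restr//; apply/asboolP; exists y; split=> //; exact: cyl_restr_self.
move=> [y [Ky Uy]]; have [n nU] := (open_cantorP V).1 oU _ Uy.
exists n => // K' hK'.
have : tree (Kset K') (restr y n).
  rewrite hK' ?size_restr//; apply/asboolP; exists y; split=> //; exact: cyl_restr_self.
by move=> /asboolP[w [Kw /nU Uw]]; exists w.
Qed.

Lemma continuous_compK (Z : topologicalType) (F : Z -> compK) :
  (forall z n, \forall z' \near z, same_tree n (F z) (F z')) -> continuous F.
Proof.
move=> hF z V /nbhs_compK[n hn]; apply: filterS (hF z n) => z'; exact: hn.
Qed.

(** * Analytic sets and clopen trees *)

Section polish_schemes.

Definition metric_of (T : topologicalType) (d : T -> T -> Real) :=
  [/\ (forall x y, 0 <= d x y) /\ (forall x y, d x y = 0 <-> x = y),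
        (forall x y, d x y = d y x),
        (forall x y z, d x z <= d x y + d y z) &
        (forall A : set T, open A <->
           (forall x, A x -> exists2 e : Real, 0 < e & forall y, d x y < e -> A y))].

Lemma open_ball_metric (T : topologicalType) d (x : T) (e : Real) : metric_of d ->
  open [set y | d x y < e].
Proof.
move=> [_ _ tr op]; apply/op => y /= xy; exists (e - d x y); first by rewrite subr_gt0.
by move=> z yz; have := tr x y z; lra.
Qed.

Lemma dense_sequence (T : topologicalType) d (x0 : T) :
  metric_of d -> separable_space T ->
  exists e : nat -> T, forall x (r : Real), 0 < r -> exists i, d x (e i) < r.
Proof.
move=> md [D [/countable_injP[g gi] cD]].
exists (fun i => xget x0 [set y | D y /\ g y = i]) => x r r0.
have : closure D x by rewrite cD.
move=> /(_ [set y | d x y < r]) [].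
  apply: open_nbhs_nbhs; split; first exact: open_ball_metric.
  by case: md => -[_ d0] _ _ _; rewrite /= (d0 x x).2.
move=> y [Dy xy]; exists (g y).
have [Dw gw] := @xgetPex _ x0 [set w | D w /\ g w = g y] (ex_intro _ y (conj Dy erefl)).
by rewrite (gi _ y _ _ gw) ?inE.
Qed.

(** The given clopen basis may be uncountable. Instead, one clopen set is chosen for each pair of
    balls, from a countable family, that some clopen set separates; any two distinct points lie in
    such a pair. *)
Lemma separating_clopens (Z : topologicalType) : polish Z -> zero_dim Z ->
  exists U : nat -> set Z, (forall i, clopen (U i)) /\
    forall z z', z <> z' -> exists i, U i z /\ ~ U i z'.
Proof.
move=> [sZ [d [d0 dC dT dO _]]] [B [Bcl [_ Bb]]].
have md : metric_of d by split.
have [[z0 _]|nz] := pselect (exists z : Z, True); last first.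
  exists (fun=> setT); split=> [i|z]; first by split; [exact: openT|exact: closedT].
  by exfalso; apply: nz; exists z.
have [e he] := dense_sequence z0 md sZ.
have [|U hU] := @choice _ _ (fun (q : (nat * nat) * (nat * nat)) (U : set Z) =>
  clopen U /\ ((exists V, [/\ clopen V,
    forall y, d (e q.1.1) y < 2^-1 ^+ q.1.2 -> V y &
    forall y, d (e q.2.1) y < 2^-1 ^+ q.2.2 -> ~ V y]) ->
   (forall y, d (e q.1.1) y < 2^-1 ^+ q.1.2 -> U y) /\
    forall y, d (e q.2.1) y < 2^-1 ^+ q.2.2 -> ~ U y)).
  move=> q; have [[V [cV h1 h2]]|h] := pselect (exists V, [/\ clopen V,
    forall y, d (e q.1.1) y < 2^-1 ^+ q.1.2 -> V y &
    forall y, d (e q.2.1) y < 2^-1 ^+ q.2.2 -> ~ V y]).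
    by exists V.
  by exists setT; split; [split; [exact: openT|exact: closedT]|].
have approx y r : 0 < r -> exists i k, d (e i) y < 2^-1 ^+ k /\
    forall w, d (e i) w < 2^-1 ^+ k -> d y w < r.
  move=> r0; have [k hk] := @half_exp_lt (r / 2) ltac:(lra).
  have [i hi] := he y (2^-1 ^+ k) ltac:(by rewrite exprn_gt0//; lra).
  exists i, k; split; first by rewrite dC.
  by move=> w hw; have := dT y (e i) w; lra.
exists (fun n => if unpickle n is Some q then U q else setT); split.
  move=> i; case: unpickle => [q|]; first exact: (hU q).1.
  by split; [exact: openT|exact: closedT].
move=> z z' zz'.
have dpos : 0 < d z z'.
  by rewrite lt_neqAle d0.1 andbT eq_sym; apply/eqP => /d0.2.
have : nbhs z [set y | d z y < d z z'].
  apply: open_nbhs_nbhs; split; first exact: open_ball_metric.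
  by rewrite /= (d0.2 z z).2.
move=> /Bb[V [BV Vz] Vsub]; have [oV cV] := Bcl _ BV.
have Vz' : ~ V z' by move=> /Vsub/=; rewrite ltxx.
have [r r0 hr] := (dO V).1 oV _ Vz.
have [r' r'0 hr'] := (dO (~` V)).1 (closed_openC cV) _ Vz'.
have [i [k [ik1 ik2]]] := approx z r r0.
have [j [l [jl1 jl2]]] := approx z' r' r'0.
exists (pickle ((i, k), (j, l))); rewrite pickleK.
have [|h1 h2] := (hU ((i, k), (j, l))).2.
  by exists V; split=> // y /= ?; [apply/hr/ik2|apply/hr'/jl2].
by split; [exact: h1|exact: h2].
Qed.

(* In [T z s] the point [y] is a preimage of [z] up to precision [size s]:
   [s] lists balls shrinking around [y], and [f y] lies on the same side as
   [z] of the first [size s] separating clopen sets. *)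
Lemma analytic_scheme (Z : topologicalType) (A : set Z) :
  polish Z -> zero_dim Z -> analytic A ->
  exists T : Z -> seq nat -> Prop,
    (forall s z, \forall z' \near z, T z' s <-> T z s) /\
    forall z, A z <-> exists w : nat -> nat, forall n, T z (mkseq w n).
Proof.
move=> pZ zZ; have [U [Ucl Usep]] := separating_clopens pZ zZ.
case=> [->|[Y [f [[sY [d [d0 dC dT dO dcomp]]] cf <-]]]].
  exists (fun _ _ => False); split; first by move=> s z; apply: nearW.
  by move=> z; split=> // -[w /(_ 0%N)].
have md : metric_of d by split.
have [[y0 _]|nY] := pselect (exists y : Y, True); last first.
  exists (fun _ _ => False); split; first by move=> s z; apply: nearW.
  move=> z; split; last by move=> -[w /(_ 0%N)].
  by move=> [y _ _]; exfalso; apply: nY; exists y.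
have [e he] := dense_sequence y0 md sY.
exists (fun z s => exists y, (forall i, (i < size s)%N -> d y (e (nth 0%N s i)) < 2^-1 ^+ i) /\
   forall i, (i < size s)%N -> U i z <-> U i (f y)).
split.
  move=> s z.
  have : \forall z' \near z, forall i, (i < size s)%N -> U i z' <-> U i z.
    elim: (size s) => [|n IH]; first by apply: nearW.
    have h : \forall z' \near z, U n z' <-> U n z.
      have [Uz|nUz] := pselect (U n z).
        by apply: filterS (open_nbhs_nbhs (conj (Ucl n).1 Uz)) => z' Uz'.
      have oC := closed_openC (Ucl n).2.
      by apply: filterS (open_nbhs_nbhs (conj oC nUz)) => z' Uz'; split=> // /Uz'.
    by apply: filterS2 IH h => z' h1 h2 i; rewrite ltnS leq_eqVlt => /orP[/eqP->//|]; exact: h1.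
  apply: filterS => z' h; split=> -[y [h1 h2]]; exists y; split=> // i ilt.
    by rewrite -h2 // h.
  by rewrite -h2 // h.
move=> z; split.
  move=> [y _ <-].
  have [w hw] := @choice _ _ (fun i k => d y (e k) < 2^-1 ^+ i)
    (fun i => he y (2^-1 ^+ i) ltac:(by rewrite exprn_gt0//; lra)).
  exists w => n; exists y; split=> [i|//]; rewrite size_mkseq => ilt.
  by rewrite nth_mkseq.
move=> [w hw].
have [u hu] := choice hw.
have close i n : (i < n)%N -> d (u n) (e (w i)) < 2^-1 ^+ i.
  by move=> ilt; have := (hu n).1 i; rewrite size_mkseq nth_mkseq//; apply.
have [r r0|y hy] := dcomp u.
  have [N hN] := @half_exp_lt (r / 2) ltac:(lra).
  exists N.+1 => m n Nm Nn; have := dT (u m) (e (w N)) (u n).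
  by have := close N m Nm; have := close N n Nn; rewrite (dC (u n)); lra.
exists y => //; apply: contrapT => fyz.
have [i [Uz nUf]] := Usep _ _ (fun h => fyz (esym h)).
have oC : open (f @^-1` (~` U i)).
  by move/continuousP: cf; apply; exact: closed_openC (Ucl i).2.
have [r r0 hr] := (dO _).1 oC y nUf.
have [N hN] := hy r r0.
have := hN (maxn N i.+1) (leq_maxl _ _); rewrite dC => /hr; apply.
by apply: ((hu (maxn N i.+1)).2 i _).1 => //; rewrite size_mkseq leq_maxr.
Qed.

End polish_schemes.

(** * Hardness *)

(* [label] takes every value infinitely often, so that the increasing sequence
   of positions of ones in a bit sequence can code an arbitrary sequence. *)
Definition label (i : nat) : nat := logn 2 i.+1.

Lemma label_inf k N : exists2 i, (N <= i)%N & label i = k.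
Proof.
exists ((2 ^ k * N.*2.+1).-1).
  rewrite -ltnS prednK ?muln_gt0 ?expn_gt0//.
  apply: (@leq_trans N.*2.+1); first by rewrite ltnS -addnn leq_addr.
  by rewrite leq_pmull// expn_gt0.
rewrite /label prednK ?muln_gt0 ?expn_gt0// lognM ?expn_gt0//.
by rewrite pfactorK// (@logn_coprime 2) ?addn0// coprime2n /= odd_double.
Qed.

Definition ones (s : seq bool) : seq nat :=
  [seq label i | i <- iota 0 (size s) & nth false s i].

Definition inf_ones (x : cantor_space) := forall N, exists2 i, (N <= i)%N & x i.

Lemma ones_rcons s b : ones (rcons s b) = ones s ++ (if b then [:: label (size s)] else [::]).
Proof.
rewrite /ones size_rcons -addn1 iotaD filter_cat map_cat add0n; congr (_ ++ _).
  congr map; apply: eq_in_filter => i; rewrite mem_iota add0n => /andP[_ ilt].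
  by rewrite nth_rcons ilt.
by rewrite /= nth_rcons ltnn eqxx; case: b.
Qed.

Lemma ones_restr_prefix x n m : (n <= m)%N ->
  exists t, ones (restr x m) = ones (restr x n) ++ t.
Proof.
move=> /subnKC <-; elim: (m - n)%N => [|k [t IH]].
  by exists [::]; rewrite addn0 cats0.
by rewrite addnS restrS ones_rcons IH -catA; eexists.
Qed.

Lemma size_ones_unbounded x : inf_ones x -> forall k, exists n, size (ones (restr x n)) = k.
Proof.
move=> ix; elim=> [|k [n hn]]; first by exists 0%N.
have ex : exists i, (n <= i)%N && x i by have [i ni xi] := ix n; exists i; rewrite ni.
case: (ex_minnP ex) => i /andP[ni xi] imin; exists i.+1.
have hi : size (ones (restr x i)) = k.
  have : forall j, (n + j <= i)%N -> size (ones (restr x (n + j)%N)) = k.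
    elim=> [|j IH]; first by rewrite addn0.
    rewrite addnS => ji; rewrite restrS ones_rcons.
    case xj: (x (n + j)%N); last by rewrite cats0 IH// ltnW.
    by have := imin (n + j)%N; rewrite leq_addr xj leqNgt ji => /(_ isT).
  by move=> /(_ (i - n)%N); rewrite subnKC//; apply.
by rewrite restrS ones_rcons xi size_cat hi addn1.
Qed.

Lemma branch_of_ones (T : seq nat -> Prop) x : inf_ones x ->
  (forall n, T (ones (restr x n))) -> exists w : nat -> nat, forall n, T (mkseq w n).
Proof.
move=> /size_ones_unbounded hx hT.
have [m hm] := choice hx.
exists (fun k => nth 0%N (ones (restr x (m k.+1))) k) => n.
have -> : mkseq (fun k => nth 0%N (ones (restr x (m k.+1))) k) n = ones (restr x (m n)); last exact: hT.
apply: (@eq_from_nth _ 0%N); rewrite size_mkseq ?hm// => k kn; rewrite nth_mkseq//.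
case: (leqP (m k.+1) (m n)) => [/(ones_restr_prefix x)[t ->]|/ltnW/(ones_restr_prefix x)[t ->]].
  by rewrite nth_cat hm ltnSn.
by rewrite nth_cat hm kn.
Qed.

(** Since labels recur forever, positions labelled [w 0], [w 1], ... can be picked in increasing
    order and past any [N]; the freedom in [N] makes the codes of one branch accumulate at the zero
    sequence. *)
Lemma ones_of_branch (T : seq nat -> Prop) (w : nat -> nat) N :
  (forall n, T (mkseq w n)) ->
  exists x, [/\ inf_ones x, (forall n, T (ones (restr x n))) & forall i, (i < N)%N -> x i = false].
Proof.
move=> hw.
have [p hp] := @choice _ _ (fun (q : nat * nat) i => (q.2 <= i)%N /\ label i = q.1)
  (fun q => let: ex_intro2 i a b := label_inf q.1 q.2 in ex_intro _ i (conj a b)).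
pose fix pos k := if k is k'.+1 then p (w k, (pos k').+1) else p (w 0%N, N).
have lpos k : label (pos k) = w k by case: k => [|k]; [exact: (hp (w 0%N, N)).2|exact: (hp (w k.+1, (pos k).+1)).2].
have posN : (N <= pos 0%N)%N by have [] := hp (w 0%N, N).
have posS k : (pos k < pos k.+1)%N by have [] := hp (w k.+1, (pos k).+1).
have mono : {homo pos : i j / (i < j)%N}.
  by apply: homo_ltn => // ? ? ?; exact: ltn_trans.
have monoe j k : (pos j < pos k)%N -> (j < k)%N.
  by move=> h; rewrite ltnNge leq_eqVlt; apply/negP => /orP[/eqP e|/mono]; move: h; rewrite ?e; lia.
have posk k : (k <= pos k)%N by elim: k => [//|k IH]; exact: leq_ltn_trans (posS k).
pose x : cantor_space := fun i => `[< exists k, pos k = i >].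
exists x; split.
- by move=> M; exists (pos M); [exact: posk|apply/asboolP; exists M].
- move=> n; suff [k [-> _]] : exists k, ones (restr x n) = mkseq w k /\
     forall j, (pos j < n)%N <-> (j < k)%N by exact: hw.
  elim: n => [|n [k [IH1 IH2]]]; first by exists 0%N.
  rewrite restrS ones_rcons size_restr; case: (boolP (x n)) => [/asboolP[j jn]|xn].
    have jk : j = k.
      apply/eqP; rewrite eqn_leq; apply/andP; split; last first.
        by rewrite leqNgt; apply/negP => /(IH2 j); rewrite jn ltnn.
      rewrite leqNgt; apply/negP => kj.
      by have := (IH2 k).1; rewrite -jn mono// ltnn => /(_ isT).
    subst j; exists k.+1; rewrite mkseqS IH1 -jn lpos cats1; split=> // j.
    rewrite !ltnS; split=> [h|]; first by rewrite leqNgt; apply/negP => /mono; lia.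
    by rewrite leq_eqVlt => /orP[/eqP->|/mono]; lia.
  exists k; rewrite cats0; split=> // j; rewrite -IH2; split=> [|/ltnW//].
  rewrite ltnS leq_eqVlt => /orP[/eqP e|//].
  by move/negP: xn; case; apply/asboolP; exists j.
- move=> i iN; apply/negbTE/asboolPn => -[k ki].
  move: iN; rewrite -ki ltnNge; apply/negP/negPn.
  by apply: leq_trans posN _; case: k {ki} => // k; apply/ltnW/mono.
Qed.

Lemma not_cvg_two_values (u : nat -> Real) a b : a <> b ->
  (forall N, exists2 n, (N <= n)%N & u n = a) ->
  (forall N, exists2 n, (N <= n)%N & u n = b) -> ~ cvgn u.
Proof.
move=> ab ha hb /cvg_ex[l ul].
have lim c : (forall N, exists2 n, (N <= n)%N & u n = c) -> l = c.
  move=> hc; apply/eqP; rewrite -subr_eq0 -normr_eq0 eq_le normr_ge0 andbT.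
  apply/ler_addgt0Pr => e e0; move/cvgrPdist_lt: ul => /(_ e e0)[N _ hN].
  by have [n Nn <-] := hc N; rewrite add0r; apply: ltW; exact: hN.
by apply: ab; rewrite -(lim a)// -(lim b).
Qed.

Section spine.
Context (H : set cantor_space) (cH : closed H).

(** The first bit splits the spine: the [false] side carries a copy of [H] whatever [T] is, the
    [true] side carries the codes of branches of [T]. *)
Definition spine_tree (T : seq nat -> Prop) (s : seq bool) : Prop :=
  match s with
  | [::] => True
  | false :: s => tree H s
  | true :: s => T (ones s)
  end.

(* On the side of [true], [sharp_value] oscillates with an amplitude which decreases
   with the number of ones met, while [blur_value] only changes at ones: the
   former converges, and the latter diverges, iff there are infinitely many ones. *)
Definition sharp_value (s : seq bool) : Real :=
  if s is true :: s' then 2^-1 + (-1) ^+ size s' * 2^-1 ^+ (count id s').+3 else 2^-1.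

Definition blur_value (s : seq bool) : Real :=
  match s with
  | [::] => 2^-1
  | false :: s => 2^-1 + (-1) ^+ size s * 2^-1 ^+ 3
  | true :: s => 2^-1 + (-1) ^+ count id s * 2^-1 ^+ 3
  end.

Definition limit_set (T : seq nat -> Prop) : set cantor_space :=
  [set x | (forall n, spine_tree T (restr x n)) /\ (x 0%N -> inf_ones (tail 1 x))].

Lemma dyadic_perturb n m : dyadic (2^-1 + (-1) ^+ n * 2^-1 ^+ m) .
Proof.
apply: dyadicD; first by exists 1%N, 1; rewrite mul1r.
by exists m, ((-1) ^+ n); rewrite rmorphXn/= rmorphN1 exprVn.
Qed.

(** An exponent of at least 3 keeps the perturbation within 1/8, the half-width of [3/8, 5/8]. *)
Lemma bound_perturb n m :
  3 / 8 <= (2^-1 + (-1) ^+ n * 2^-1 ^+ m.+3 : Real) <= 5/8.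
Proof.
have := half_exp_le (leq_addl m 3); rewrite addn3 => h.
have h0 : 0 <= (2^-1 : Real) ^+ m.+3 by rewrite exprn_ge0.
rewrite -signr_odd; move: h; set q := 2^-1 ^+ m.+3 in h0 *; rewrite !exprS expr0.
by case: (odd n) => /=; rewrite ?expr1 ?expr0 => h1; apply/andP; split; lra.
Qed.

Lemma sharp_value_bounds s : dyadic (sharp_value s) /\ 3/8 <= sharp_value s <= 5/8.
Proof.
have h0 : dyadic (2^-1) /\ 3/8 <= (2^-1 : Real) <= 5/8.
  by split; [exists 1%N, 1; rewrite mul1r|lra].
by case: s => [//|[] s]//; split; [exact: dyadic_perturb|exact: bound_perturb].
Qed.

Lemma blur_value_bounds s : dyadic (blur_value s) /\ 3/8 <= blur_value s <= 5/8.
Proof.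
case: s => [|[] s]; try by split; [exact: dyadic_perturb|exact: bound_perturb].
by split; [exists 1%N, 1; rewrite mul1r|rewrite /=; lra].
Qed.

Lemma restr_cons (x : cantor_space) n : restr x n.+1 = x 0%N :: restr (tail 1 x) n.
Proof.
rewrite /restr /mkseq -[n.+1]add1n iotaD /= add0n; congr cons.
by rewrite -[1%N]addn0 iotaDl -map_comp.
Qed.

Lemma count_restr_inf x : inf_ones x -> forall N, \forall n \near \oo, (N <= count id (restr x n))%N.
Proof.
move=> ix; elim=> [|N [M _ IH]]; first exact: nearW.
have [i Mi xi] := ix M; exists i.+1 => // n /subnKC <-.
have h : (N <= count id (restr x i))%N := IH i Mi.
elim: (n - i.+1)%N => [|k IHk].
  by rewrite addn0 restrS -cats1 count_cat/= xi; lia.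
by rewrite addnS restrS -cats1 count_cat (leq_trans IHk)// leq_addr.
Qed.

Lemma count_restr_fin x : ~ inf_ones x -> exists c, \forall n \near \oo, count id (restr x n) = c.
Proof.
move=> /existsNP[N hN]; exists (count id (restr x N)); exists N => // n /subnKC <-.
elim: (n - N)%N => [|k IH]; first by rewrite addn0.
rewrite addnS restrS -cats1 count_cat IH /=.
case xk: (x (N + k)%N); last by rewrite !addn0.
by exfalso; apply: hN; exists (N + k)%N => //; exact: leq_addr.
Qed.

Lemma signs_not_cvg (u : nat -> Real) (k : nat) (r : Real) : r != 0 ->
  (\forall n \near \oo, u (n + k)%N = 2^-1 + (-1) ^+ n * r) -> ~ cvgn u.
Proof.
move=> r0 [M _ hM]; apply: (@not_cvg_two_values _ (2^-1 + r) (2^-1 - r)).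
- by move=> e; move/eqP: r0; apply; lra.
- move=> N; exists ((maxn M N).*2 + k)%N; first by lia.
  by rewrite hM /=; [rewrite -signr_odd odd_double expr0 mul1r|lia].
- move=> N; exists ((maxn M N).*2.+1 + k)%N; first by lia.
  by rewrite hM /=; [rewrite -signr_odd /= odd_double expr1 mulN1r|lia].
Qed.

Lemma cvg_sharp x :
  cvgn (fun n => sharp_value (restr x n)) <-> (x 0%N -> inf_ones (tail 1 x)).
Proof.
have e n : sharp_value (restr x n.+1) = if x 0%N then
  2^-1 + (-1) ^+ n * 2^-1 ^+ (count id (restr (tail 1 x) n)).+3 else 2^-1.
  by rewrite restr_cons /= size_restr; case: (x 0%N).
case x0: (x 0%N) in e *; last first.
  split=> // _; apply/cvg_ex; exists 2^-1; rewrite -(cvg_shiftS (fun n => sharp_value (restr x n))).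
  by apply: cvg_near_cst; apply: nearW.
split=> [cv _|/(_ isT) ix].
  apply: contrapT => /count_restr_fin[c hc]; move: cv.
  apply: (@signs_not_cvg _ 1%N (2^-1 ^+ c.+3)); first by rewrite expf_neq0.
  by apply: filterS hc => n hn; rewrite addn1 e hn.
apply/cvg_ex; exists 2^-1; rewrite -(cvg_shiftS (fun n => sharp_value (restr x n))).
apply/cvgrPdist_lt => r r0; have [N hN] := half_exp_lt r0.
apply: filterS (count_restr_inf ix N) => n hn.
rewrite -[X in _ - X]/(sharp_value (restr x n.+1)) e opprD addrA subrr sub0r normrN normrM.
rewrite normrX normrN1 expr1n mul1r ger0_norm ?exprn_ge0//.
by apply: le_lt_trans hN; apply: half_exp_le; lia.
Qed.

Lemma cvg_blur x :
  (~ cvgn (fun n => blur_value (restr x n))) <-> (x 0%N -> inf_ones (tail 1 x)).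
Proof.
case x0: (x 0%N); last first.
  split=> // _; apply: (@signs_not_cvg _ 1%N (2^-1 ^+ 3)); first by rewrite expf_neq0.
  by apply: nearW => n; rewrite addn1 restr_cons x0/= size_restr.
have e n : blur_value (restr x n.+1) = 2^-1 + (-1) ^+ count id (restr (tail 1 x) n) * 2^-1 ^+ 3.
  by rewrite restr_cons x0.
split=> [nc _|/(_ isT) ix].
  apply: contrapT => /count_restr_fin[c hc]; apply: nc.
  apply/cvg_ex; exists (2^-1 + (-1) ^+ c * 2^-1 ^+ 3).
  rewrite -(cvg_shiftS (fun n => blur_value (restr x n))).
  by apply: cvg_near_cst; apply: filterS hc => n hn; rewrite -[LHS]/(blur_value (restr x n.+1)) e hn.
(* The count grows by at most one per bit and is unbounded, so it skips no value and both parities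
   recur. *)
have hit k N : exists2 n, (N <= n)%N & count id (restr (tail 1 x) n) = (count id (restr (tail 1 x) N) + k)%N.
  elim: k => [|k [n Nn IH]]; first by exists N; rewrite ?addn0.
  have ex : exists i, (n <= i)%N && (tail 1 x i) by have [i ni xi] := ix n; exists i; rewrite ni.
  case: (ex_minnP ex) => i /andP[ni xi] imin; exists i.+1; first by lia.
  have : forall j, (n + j <= i)%N -> count id (restr (tail 1 x) (n + j)%N) = (count id (restr (tail 1 x) N) + k)%N.
    elim=> [|j IHj]; first by rewrite addn0.
    rewrite addnS => ji; rewrite restrS -cats1 count_cat /=.
    case xj: (tail 1 x (n + j)%N); first by have := imin (n + j)%N; rewrite leq_addr xj leqNgt ji => /(_ isT).
    by rewrite !addn0 IHj// ltnW.
  move=> /(_ (i - n)%N); rewrite subnKC// => /(_ (leqnn _)) h.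
  by rewrite restrS -cats1 count_cat h /= xi; lia.
have par b N : exists2 n, (N <= n)%N & odd (count id (restr (tail 1 x) n)) = b.
  have [n Nn hn] := hit (odd (count id (restr (tail 1 x) N)) (+) b : nat) N.
  by exists n => //; rewrite hn oddD oddb addbA addbb.
apply: (@not_cvg_two_values _ (2^-1 + 2^-1 ^+ 3) (2^-1 - 2^-1 ^+ 3)).
- by rewrite !exprS expr0; lra.
- move=> N; have [n Nn hn] := par false N; exists n.+1; first by lia.
  by rewrite e -signr_odd hn expr0 mul1r.
- move=> N; have [n Nn hn] := par true N; exists n.+1; first by lia.
  by rewrite e -signr_odd hn expr1 mulN1r.
Qed.

Lemma Sharp_spine T : Sharp (gadget (spine_tree T) sharp_value) = spread @` limit_set T.
Proof.
rewrite Sharp_gadget; last exact: sharp_value_bounds.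
by congr (_ @` _); apply/seteqP; split=> x [h1 h2]; split=> //; apply/cvg_sharp.
Qed.

Lemma Blur_spine T : Blur (gadget (spine_tree T) blur_value) = spread @` limit_set T.
Proof.
rewrite Blur_gadget; last exact: blur_value_bounds.
by congr (_ @` _); apply/seteqP; split=> x [h1 h2]; split=> //; apply/cvg_blur.
Qed.

End spine.

Lemma near_strings (Z : topologicalType) (z : Z) (P : Z -> seq bool -> Prop) n :
  (forall s, \forall z' \near z, P z' s) ->
  \forall z' \near z, forall s, (size s <= n)%N -> P z' s.
Proof.
elim: n P => [|n IH] P hP.
  by apply: filterS (hP [::]) => z' h [].
apply: filterS3 (hP [::]) (IH (fun z' s => P z' (true :: s)) (fun s => hP _))
  (IH (fun z' s => P z' (false :: s)) (fun s => hP _)) => z' h0 h1 h2 [|[] s]//=.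
- by rewrite ltnS; exact: h1.
- by rewrite ltnS; exact: h2.
Qed.

Section hardness.
Context (H : set cantor_space) (kH : compact H).

Lemma limit_setE T x : limit_set H T x <->
  if x 0%N then inf_ones (tail 1 x) /\ forall n, T (ones (restr (tail 1 x) n)) else H (tail 1 x).
Proof.
rewrite /limit_set /=; case x0: (x 0%N); split.
- by move=> [h1 h2]; split; [exact: h2|move=> n; have := h1 n.+1; rewrite restr_cons x0].
- move=> [h1 h2]; split=> // -[|n]; first by [].
  by rewrite restr_cons x0; exact: h2.
- move=> [h _]; move/compact_cantorP/closed_cantorP: kH; apply=> n.
  by have := h n.+1; rewrite restr_cons x0 => /asboolP[y []]; exists y.
- move=> hx; split=> // -[|n]; first by [].
  rewrite restr_cons x0; apply/asboolP; exists (tail 1 x); split=> //.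
  exact: cyl_restr_self.
Qed.

Lemma limit_set_homeomorphic T : ~ (exists w : nat -> nat, forall n, T (mkseq w n)) ->
  homeomorphic (spread @` limit_set H T) H.
Proof.
move=> nb; have H0 x : limit_set H T x -> x 0%N = false /\ H (tail 1 x).
  move/limit_setE; case: (x 0%N) => // -[ix hx]; exfalso.
  by apply: nb; exact: branch_of_ones ix hx.
have te x : tail 1 (app [:: false] x) = x by exact: (tail_app [:: false]).
exists (fun y => tail 1 (unspread y)), (fun x => spread (app [:: false] x)); split.
- split; apply/continuous_within_cantorP => x n _.
    exists (n.+2).*2 => y _ /cyl_restr h; apply/cyl_restr => i ilt.
    by rewrite /tail /unspread h//; lia.
  exists n => y _ /cyl_restr h; apply/cyl_restr => i ilt.
  rewrite /spread /app; case: (odd i) => //; case: ltnP => // i2.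
  by rewrite h//=; lia.
- by move=> _ [_ [x /H0[_ hx] <-] <-]; rewrite spreadK.
- by move=> _ [x Hx <-]; exists (app [:: false] x) => //; apply/limit_setE; rewrite /= te.
- move=> _ [x /H0[x0 _] <-]; rewrite spreadK; congr spread.
  by rewrite (app_tail (s := [:: false]))// => -[|//] _; rewrite x0.
- by move=> x _; rewrite spreadK te.
Qed.

Lemma homeomorphic_compact A : homeomorphic A H -> compact A.
Proof.
move=> [f [g [[_ cg] fA gH gf _]]].
have -> : A = g @` H.
  apply/seteqP; split=> [x Ax|_ [y Hy <-]]; last by apply: gH; exists y.
  by exists (f x); [apply: fA; exists x|exact: gf].
exact: continuous_compact.
Qed.

(* Branches of [T] are coded by points whose first one occurs arbitrarily late,
   so they accumulate at a point outside the limit set. *)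
Lemma limit_set_not_homeomorphic T : (exists w : nat -> nat, forall n, T (mkseq w n)) ->
  ~ homeomorphic (spread @` limit_set H T) H.
Proof.
move=> [w hw] /homeomorphic_compact/compact_cantorP/closed_cantorP cA.
have te x : tail 1 (app [:: true] x) = x by exact: (tail_app [:: true]).
have [|x] := cA (spread (app [:: true] (fun=> false))).
  move=> n; have [x [ix hx xn]] := ones_of_branch n hw.
  exists (spread (app [:: true] x)).
    by exists (app [:: true] x) => //; apply/limit_setE; rewrite /= te.
  apply/cyl_restr => i ilt; rewrite /spread /app; case: (odd i) => //; case: ltnP => // i2.
  by rewrite xn//=; lia.
move=> /limit_setE hx /(congr1 unspread); rewrite !spreadK => xE.
by move: hx; rewrite xE /= te => -[/(_ 0%N)[]].
Qed.

(** Serves [Sharp] and [Blur] alike. The tree [T z] has a branch exactly when [z] is outside [B],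
    and each of its nodes is decided on a neighbourhood of [z], which gives continuity through
    [gadget_tree_local]. *)
Lemma hard_gadget (v : seq bool -> Real) (A : compK -> set cantor_space) :
  (forall s, dyadic (v s) /\ 3/8 <= v s <= 5/8) ->
  (forall T K, Kset K = gadget (spine_tree H T) v -> A K = spread @` limit_set H T) ->
  forall Z : topologicalType, polish Z -> zero_dim Z ->
    forall B : set Z, coanalytic B ->
      exists f : Z -> compK, continuous f /\ B = f @^-1` [set K | homeomorphic (A K) H].
Proof.
move=> hv hA Z pZ zZ B /(analytic_scheme pZ zZ)[T [Tloc hT]].
have kG z : compact (gadget (spine_tree H (T z)) v).
  by apply/compact_cantorP; exact: gadget_closed.
exists (fun z => CompK (kG z)); split.
  apply: continuous_compK => z n /=.
  have loc : \forall z' \near z, forall s, (size s <= n)%N ->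
      spine_tree H (T z') s <-> spine_tree H (T z) s.
    by apply: near_strings => -[|[] s] /=; try exact: nearW.
  apply: filterS loc => z' loc t tn; apply/idP/idP; apply: (@gadget_tree_local _ _ _ n) => // s sn;
    by have [l1 l2] := loc s sn; split.
apply/seteqP; split=> z /=; rewrite (hA (T z))//.
  move=> Bz; apply: limit_set_homeomorphic => /hT; exact.
move=> hz; apply: contrapT => /hT; apply: contraPnot hz; exact: limit_set_not_homeomorphic.
Qed.

End hardness.

(** * Analytic predicates on coded spaces *)

(* Points of a coded space are determined by sequences of naturals; continuity
   refers to the topology induced by the Baire space. *)
Class Coded (X : Type) := coord : X -> nat -> nat.

#[export] Instance coded_fun (I V : countType) : Coded (I -> V) :=
  fun x n => if unpickle n is Some i then pickle (x i) else 0%N.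
#[export] Instance coded_prod (X Y : Type) (cX : Coded X) (cY : Coded Y) : Coded (X * Y) :=
  fun p n => if odd n then coord p.2 n./2 else coord p.1 n./2.

Notation baire := (nat -> nat).

Section coded.
Context {X : Type} {cX : Coded X}.

Definition agree n (x x' : X) := forall i, (i < n)%N -> coord x i = coord x' i.

Lemma agree_sym n x x' : agree n x x' -> agree n x' x.
Proof. by move=> h i ilt; rewrite h. Qed.

Lemma agree_trans n x y z : agree n x y -> agree n y z -> agree n x z.
Proof. by move=> h1 h2 i ilt; rewrite h1// h2. Qed.

Lemma agree_le n m x x' : (n <= m)%N -> agree m x x' -> agree n x x'.
Proof. by move=> nm h i ilt; apply: h; exact: leq_trans nm. Qed.

(** Continuity for the discrete topology on [V]; with [V] taken to be [Prop], this means a clopen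
    predicate. *)
Definition lcf {V : Type} (f : X -> V) :=
  forall x, exists n, forall x', agree n x x' -> f x' = f x.

Lemma lcf_const V (v : V) : lcf (fun=> v).
Proof. by move=> x; exists 0%N. Qed.

Lemma lcf_case V W (f : X -> V) (F : V -> X -> W) :
  lcf f -> (forall v, lcf (F v)) -> lcf (fun x => F (f x) x).
Proof.
move=> hf hF x; have [n hn] := hf x; have [m hm] := hF (f x) x.
exists (maxn n m) => x' xx'; rewrite hn ?hm//.
  by apply: agree_le xx'; exact: leq_maxr.
by apply: agree_le xx'; exact: leq_maxl.
Qed.

Lemma lcf_map V W (g : V -> W) (f : X -> V) : lcf f -> lcf (fun x => g (f x)).
Proof. by move=> hf x; have [n hn] := hf x; exists n => x' /hn ->. Qed.

Lemma lcf_map2 V W U (h : V -> W -> U) (f : X -> V) (g : X -> W) :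
  lcf f -> lcf g -> lcf (fun x => h (f x) (g x)).
Proof. by move=> hf hg; apply: (lcf_case (F := fun v x => h v (g x))) => // v; exact: lcf_map. Qed.

Lemma lcf_mkseq V (f : nat -> X -> V) n : (forall i, lcf (f i)) ->
  lcf (fun x => mkseq (fun i => f i x) n).
Proof.
move=> hf; elim: n => [|n IH]; first exact: lcf_const.
rewrite (_ : (fun x => _) = fun x => rcons (mkseq (fun i => f i x) n) (f n x)).
  exact: lcf_map2.
by apply/funext => x; rewrite mkseqS.
Qed.

Lemma lcf_agree V (f : X -> V) n : (forall x x', agree n x x' -> f x' = f x) -> lcf f.
Proof. by move=> h x; exists n => x'; exact: h. Qed.

End coded.

Definition cts {X Y : Type} {cX : Coded X} {cY : Coded Y} (phi : X -> Y) :=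
  forall n, lcf (fun x => coord (phi x) n).

Lemma cts_agree {X Y : Type} {cX : Coded X} {cY : Coded Y} (phi : X -> Y) :
  cts phi -> forall x n, exists m, forall x', agree m x x' -> agree n (phi x) (phi x').
Proof.
move=> cp x; elim=> [|n [m IH]]; first by exists 0%N.
have [k hk] := cp n x; exists (maxn m k) => x' h i; rewrite ltnS leq_eqVlt => /orP[/eqP->|].
  by rewrite hk//; apply: agree_le h; exact: leq_maxr.
by apply: IH; apply: agree_le h; exact: leq_maxl.
Qed.

Lemma lcf_comp {X Y : Type} {cX : Coded X} {cY : Coded Y} V (phi : X -> Y) (f : Y -> V) :
  lcf f -> cts phi -> lcf (fun x => f (phi x)).
Proof.
move=> hf cp x; have [n hn] := hf (phi x); have [m hm] := cts_agree cp x n.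
by exists m => x' /hm/hn.
Qed.

Lemma cts_fst {X Y : Type} {cX : Coded X} {cY : Coded Y} : cts (fun p : X * Y => p.1).
Proof.
move=> n; apply: (@lcf_agree _ _ _ _ n.*2.+1) => x x' /(_ n.*2); rewrite leqnn => /(_ isT).
by rewrite {1 2}/coord /coded_prod odd_double doubleK.
Qed.

Lemma cts_snd {X Y : Type} {cX : Coded X} {cY : Coded Y} : cts (fun p : X * Y => p.2).
Proof.
move=> n; apply: (@lcf_agree _ _ _ _ n.*2.+2) => x x' /(_ n.*2.+1); rewrite leqnn => /(_ isT).
by rewrite {1 2}/coord /coded_prod oddS odd_double/= uphalf_double.
Qed.

Lemma cts_pair {X Y Z : Type} {cX : Coded X} {cY : Coded Y} {cZ : Coded Z}
  (f : X -> Y) (g : X -> Z) : cts f -> cts g -> cts (fun x => (f x, g x)).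
Proof.
move=> cf cg n; rewrite /coord /coded_prod; case: (odd n); [exact: cg|exact: cf].
Qed.

Lemma lcf_eval {I V : countType} (i : I) : lcf (fun x : I -> V => x i).
Proof.
apply: (@lcf_agree _ _ _ _ (pickle i).+1) => x x' /(_ (pickle i)); rewrite leqnn => /(_ isT).
by rewrite /coord /coded_fun pickleK => /(pcan_inj pickleK).
Qed.

Lemma lcf_at {X : Type} {cX : Coded X} {I V : countType} (phi : X -> I -> V) i :
  cts phi -> lcf (fun x => phi x i).
Proof. by move=> cp; apply: (lcf_comp (f := fun y => y i)) cp; exact: lcf_eval. Qed.

Lemma cts_fun {X : Type} {cX : Coded X} {I V : countType} (phi : X -> I -> V) :
  (forall i, lcf (fun x => phi x i)) -> cts phi.
Proof.
move=> h n; rewrite /coord /coded_fun; case: unpickle => [i|]; last exact: lcf_const.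
exact: lcf_map.
Qed.

Lemma cts_comp {X Y Z : Type} {cX : Coded X} {cY : Coded Y} {cZ : Coded Z}
  (f : X -> Y) (g : Y -> Z) : cts g -> cts f -> cts (fun x => g (f x)).
Proof. by move=> cg cf n; exact: lcf_comp (cg n) cf. Qed.

(** Coordinate [m] of a sequence is its value at [unpickle m], so a bound on coordinates must be
    converted into a bound on indices. *)
Lemma agree_seq {V : countType} m : exists n, forall y y' : nat -> V,
  (forall i, (i < n)%N -> y i = y' i) -> agree m y y'.
Proof.
elim: m => [|m [n IH]]; first by exists 0%N.
case e: (@unpickle nat m) => [k|].
  exists (maxn n k.+1) => y y' h i; rewrite ltnS leq_eqVlt => /orP[/eqP->|].
    by rewrite /coord /coded_fun e h// leq_maxr.
  by apply: IH => j jn; apply: h; rewrite leq_max jn.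
exists n => y y' h i; rewrite ltnS leq_eqVlt => /orP[/eqP->|]; last exact: IH.
by rewrite /coord /coded_fun e.
Qed.

Lemma agree_pair {X Y : Type} {cX : Coded X} {cY : Coded Y} n (x x' : X) (y y' : Y) :
  agree n x x' -> agree n y y' -> agree n (x, y) (x', y').
Proof.
move=> h1 h2 i ilt; rewrite /coord /coded_prod/=; have h : (i./2 < n)%N by lia.
by case: (odd i); [exact: h2|exact: h1].
Qed.

(** Normal form of an analytic predicate: the projection of a closed subset of [X * baire], given as
    a countable intersection of clopen sets. *)
Definition Ana {X : Type} {cX : Coded X} (P : X -> Prop) :=
  exists C : nat -> X * baire -> Prop, (forall n, lcf (C n)) /\
    forall x, P x <-> exists y, forall n, C n (x, y).

Section ana.
Context {X : Type} {cX : Coded X}.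

Lemma Ana_ext (P Q : X -> Prop) : (forall x, P x <-> Q x) -> Ana P -> Ana Q.
Proof. by move=> h [C [hC PC]]; exists C; split=> // x; rewrite -h. Qed.

Lemma Ana_lcf (P : X -> Prop) : lcf P -> Ana P.
Proof.
move=> hP; exists (fun _ p => P p.1); split.
  by move=> n; exact: lcf_comp hP cts_fst.
by move=> x; split=> [Px|[y /(_ 0%N)]//]; exists id.
Qed.

Lemma Ana_forall_nat (P : nat -> X -> Prop) :
  (forall k, Ana (P k)) -> Ana (fun x => forall k, P k x).
Proof.
move=> /choice[C hC].
exists (fun n p => if unpickle n is Some (k, m) then C k m (p.1, fun i => p.2 (pickle (k, i))) else True).
split.
  move=> n; case: unpickle => [[k m]|]; last exact: lcf_const.
  apply: lcf_comp ((hC k).1 m) _; apply: cts_pair; first exact: cts_fst.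
  by apply: cts_fun => i; apply: (lcf_at (phi := snd)) cts_snd.
move=> x; split=> [h|[y hy] k]; last first.
  apply/(hC k).2; exists (fun i => y (pickle (k, i))) => m.
  by have := hy (pickle (k, m)); rewrite pickleK.
have [y hy] := choice (fun k => ((hC k).2 x).1 (h k)).
exists (fun j => if unpickle j is Some (k, i) then y k i else 0%N) => n.
case: unpickle => [[k m]|//] /=.
rewrite (_ : (fun i => _) = y k); first exact: hy.
by apply/funext => i; rewrite pickleK.
Qed.

Lemma Ana_exists_nat (P : nat -> X -> Prop) :
  (forall k, Ana (P k)) -> Ana (fun x => exists k, P k x).
Proof.
move=> /choice[C hC].
exists (fun n p => C (p.2 0%N) n (p.1, fun i => p.2 i.+1)); split.
  move=> n; apply: (lcf_case (f := fun p => p.2 0%N)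
    (F := fun k p => C k n (p.1, fun i => p.2 i.+1))).
    by apply: (lcf_at (phi := snd)) cts_snd.
  move=> k; apply: lcf_comp ((hC k).1 n) _; apply: cts_pair; first exact: cts_fst.
  by apply: cts_fun => i; apply: (lcf_at (phi := snd)) cts_snd.
move=> x; split=> [[k /(hC k).2[y hy]]|[y hy]].
  by exists (fun i => if i is j.+1 then y j else k).
by exists (y 0%N); apply/(hC _).2; exists (fun i => y i.+1).
Qed.

Lemma Ana_const (P : Prop) : Ana (fun _ : X => P).
Proof. exact/Ana_lcf/lcf_const. Qed.

Lemma Ana_forall (I : countType) (P : I -> X -> Prop) :
  (forall k, Ana (P k)) -> Ana (fun x => forall k, P k x).
Proof.
move=> h; apply: (@Ana_ext (fun x => forall n, if unpickle n is Some i then P i x else True)).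
  move=> x; split=> [hx k|hx n]; last by case: unpickle.
  by have := hx (pickle k); rewrite pickleK.
by apply: Ana_forall_nat => n; case: unpickle => [i|]; [exact: h|exact: Ana_const].
Qed.

Lemma Ana_exists (I : countType) (P : I -> X -> Prop) :
  (forall k, Ana (P k)) -> Ana (fun x => exists k, P k x).
Proof.
move=> h; apply: (@Ana_ext (fun x => exists n, if unpickle n is Some i then P i x else False)).
  move=> x; split=> [[n]|[k Pk]]; first by case: unpickle => // i ?; exists i.
  by exists (pickle k); rewrite pickleK.
by apply: Ana_exists_nat => n; case: unpickle => [i|]; [exact: h|exact: Ana_const].
Qed.

Lemma Ana_and (P Q : X -> Prop) : Ana P -> Ana Q -> Ana (fun x => P x /\ Q x).
Proof.
move=> hP hQ; apply: (@Ana_ext (fun x => forall b : bool, if b then P x else Q x)).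
  by move=> x; split=> [h|[? ?] []//]; split; [exact: (h true)|exact: (h false)].
by apply: (@Ana_forall bool (fun b x => if b then P x else Q x)) => -[].
Qed.

Lemma Ana_or (P Q : X -> Prop) : Ana P -> Ana Q -> Ana (fun x => P x \/ Q x).
Proof.
move=> hP hQ; apply: (@Ana_ext (fun x => exists b : bool, if b then P x else Q x)).
  by move=> x; split=> [[[]]|[]]; [left|right|exists true|exists false].
by apply: (@Ana_exists bool (fun b x => if b then P x else Q x)) => -[].
Qed.

Lemma Ana_imp_const (P : Prop) (Q : X -> Prop) : (P -> Ana Q) -> Ana (fun x => P -> Q x).
Proof.
move=> h; have [p|np] := pselect P.
  by apply: Ana_ext (h p) => x; split=> // /(_ p).
by apply: Ana_ext (Ana_const True) => x; split.
Qed.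

Lemma Ana_comp {Y : Type} {cY : Coded Y} (phi : X -> Y) (P : Y -> Prop) :
  Ana P -> cts phi -> Ana (fun x => P (phi x)).
Proof.
move=> [C [hC PC]] cp; exists (fun n p => C n (phi p.1, p.2)); split=> [n|x]; last exact: PC.
apply: lcf_comp (hC n) _; apply: cts_pair cts_snd; exact: cts_comp cp cts_fst.
Qed.

Lemma Ana_ex_baire (P : X * baire -> Prop) : Ana P -> Ana (fun x => exists y, P (x, y)).
Proof.
move=> [C [hC PC]]; exists (fun n p => C n ((p.1, fun i => p.2 i.*2), fun i => p.2 i.*2.+1)).
split=> [n|x].
  apply: lcf_comp (hC n) _; apply: cts_pair; first apply: cts_pair; first exact: cts_fst.
    by apply: cts_fun => i; apply: (lcf_at (phi := snd)) cts_snd.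
  by apply: cts_fun => i; apply: (lcf_at (phi := snd)) cts_snd.
split=> [[y /PC[w hw]]|[y hy]].
  exists (fun i => if odd i then w i./2 else y i./2) => n /=.
  rewrite (_ : (fun i => _) = y); last by apply/funext => i; rewrite odd_double doubleK.
  rewrite (_ : (fun i => _) = w)//; apply/funext => i.
  by rewrite odd_double/= uphalf_double.
by exists (fun i => y i.*2); apply/PC; exists (fun i => y i.*2.+1).
Qed.

Lemma Ana_ex (I V : countType) (v0 : V) (P : X * (I -> V) -> Prop) :
  Ana P -> Ana (fun x => exists y, P (x, y)).
Proof.
(* [dec] is a continuous surjection of the Baire space onto [I -> V]; [v0] is its value on numbers
   that code nothing. *)
move=> aP; pose dec (y : baire) i : V := odflt v0 (unpickle (y (pickle (i : I)))).
apply: (@Ana_ext (fun x => exists y, P (x, dec y))).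
  move=> x; split=> [[y Py]|[y Py]]; first by exists (dec y).
  exists (fun n => if unpickle n is Some i then pickle (y i) else 0%N).
  rewrite (_ : dec _ = y)//; apply/funext => i; by rewrite /dec pickleK/= pickleK.
apply: (@Ana_ex_baire (fun p => P (p.1, dec p.2))).
have : cts (fun p : X * baire => (p.1, dec p.2)).
  apply: cts_pair; first exact: cts_fst.
  apply: cts_fun => i; apply: (lcf_map (fun k => odflt v0 (unpickle k))).
  by apply: (lcf_at (phi := snd)) cts_snd.
move=> cd; have [C [hC PC]] := aP; exists (fun n p => C n ((p.1.1, dec p.1.2), p.2)); split=> [n|p]; last exact: PC.
apply: lcf_comp (hC n) _; apply: cts_pair cts_snd; exact: cts_comp cd cts_fst.
Qed.

(** Bianalytic predicates stand in for Borel ones, with which they coincide by Suslin's theorem;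
    closure under countable operations then comes directly from that of [Ana]. *)
Definition Bi (P : X -> Prop) := Ana P /\ Ana (fun x => ~ P x).

Lemma Bi_ext (P Q : X -> Prop) : (forall x, P x <-> Q x) -> Bi P -> Bi Q.
Proof.
by move=> h [h1 h2]; split; [apply: Ana_ext h1|apply: Ana_ext h2] => // x; rewrite h.
Qed.

Lemma Bi_lcf (P : X -> Prop) : lcf P -> Bi P.
Proof. by move=> h; split; apply: Ana_lcf => //; exact: lcf_map. Qed.

Lemma Bi_const (P : Prop) : Bi (fun _ : X => P).
Proof. exact/Bi_lcf/lcf_const. Qed.

Lemma Bi_not (P : X -> Prop) : Bi P -> Bi (fun x => ~ P x).
Proof.
by move=> [h1 h2]; split=> //; apply: Ana_ext h1 => x; split=> [? //|/contrapT].
Qed.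

Lemma Bi_forall (I : countType) (P : I -> X -> Prop) :
  (forall k, Bi (P k)) -> Bi (fun x => forall k, P k x).
Proof.
move=> h; split; first by apply: Ana_forall => k; exact: (h k).1.
apply: (@Ana_ext (fun x => exists k, ~ P k x)).
  by move=> x; split=> [[k nP] /(_ k)//|/existsNP].
by apply: Ana_exists => k; exact: (h k).2.
Qed.

Lemma Bi_exists (I : countType) (P : I -> X -> Prop) :
  (forall k, Bi (P k)) -> Bi (fun x => exists k, P k x).
Proof.
move=> h; split; first by apply: Ana_exists => k; exact: (h k).1.
apply: (@Ana_ext (fun x => forall k, ~ P k x)).
  by move=> x; split=> [nP [k /nP]//|/forallNP].
by apply: Ana_forall => k; exact: (h k).2.
Qed.

Lemma Bi_and (P Q : X -> Prop) : Bi P -> Bi Q -> Bi (fun x => P x /\ Q x).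
Proof.
move=> [p1 p2] [q1 q2]; split; first exact: Ana_and.
by apply: Ana_ext (Ana_or p2 q2) => x; rewrite not_andE.
Qed.

Lemma Bi_or (P Q : X -> Prop) : Bi P -> Bi Q -> Bi (fun x => P x \/ Q x).
Proof.
move=> [p1 p2] [q1 q2]; split; first exact: Ana_or.
by apply: Ana_ext (Ana_and p2 q2) => x; rewrite not_orE.
Qed.

Lemma Bi_imp (P Q : X -> Prop) : Bi P -> Bi Q -> Bi (fun x => P x -> Q x).
Proof.
move=> hP hQ; apply: (@Bi_ext (fun x => ~ P x \/ Q x)).
  by move=> x; rewrite implyE.
by apply: Bi_or => //; exact: Bi_not.
Qed.

Lemma Bi_imp_const (P : Prop) (Q : X -> Prop) : Bi Q -> Bi (fun x => P -> Q x).
Proof. by move=> hQ; apply: Bi_imp => //; exact: Bi_const. Qed.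

End ana.

(** * Closed sections of Borel sets *)

Lemma take_mkseq A (f : nat -> A) n m : take n (mkseq f m) = mkseq f (minn n m).
Proof.
have [nm|mn] := leqP n m; last by rewrite take_oversize// size_mkseq ltnW.
by rewrite -{1}(subnKC nm) /mkseq iotaD map_cat take_size_cat ?size_map ?size_iota.
Qed.

Section games.
Context {U V : Type}.

(* For trees [T], [W]: [tree_le] is a winning strategy for the second player in
   the game where the players alternately extend nodes of [T] and of [W] and the
   first one to leave their tree loses; [tree_lt] is one for the first player.
   On well-founded trees these compare ranks. *)
Definition tree_le (T : seq V -> Prop) (W : seq U -> Prop) :=
  exists f : seq V -> U, forall t, T t ->
    W (mkseq (fun i => f (take i.+1 t)) (size t)).

Definition tree_lt (W : seq U -> Prop) (T : seq V -> Prop) :=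
  exists g : seq U -> V, forall w, W w ->
    T (mkseq (fun i => g (take i w)) (size w).+1).

Definition prefix_closed A (T : seq A -> Prop) := forall t n, T t -> T (take n t).

Inductive first_wins (T : seq V -> Prop) (W : seq U -> Prop) : seq V -> seq U -> Prop :=
  FirstWins t w v : T (rcons t v) ->
    (forall u, W (rcons w u) -> first_wins T W (rcons t v) (rcons w u)) ->
    first_wins T W t w.

(** Determinacy of an open game. [first_wins] is the winning region of the first player, defined
    inductively: inside it the chosen moves stay inside, and outside it the second player always has
    an answer that stays outside. *)
Lemma tree_compare (T : seq V -> Prop) (W : seq U -> Prop) (u0 : U) (v0 : V) :
  prefix_closed T -> prefix_closed W -> W [::] -> tree_le T W \/ tree_lt W T.
Proof.
move=> pT pW W0.
have [win|nwin] := pselect (first_wins T W [::] [::]).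
  right.
  have [|s hs] := @choice _ _ (fun (p : seq V * seq U) v => first_wins T W p.1 p.2 ->
    T (rcons p.1 v) /\ forall u, W (rcons p.2 u) -> first_wins T W (rcons p.1 v) (rcons p.2 u)).
    move=> [t w]; have [h|h] := pselect (first_wins T W t w); last by exists v0.
    by case: h => t' w' v h1 h2; exists v.
  pose step (p : seq V * seq U) u := (rcons p.1 (s p), rcons p.2 u).
  pose st w := foldl step ([::], [::]) w.
  have st2 w : (st w).2 = w.
    by elim/last_ind: w => [//|w u IH]; rewrite /st foldl_rcons /= -/(st w) IH.
  have strcons w u : (st (rcons w u)).1 = rcons (st w).1 (s (st w)).
    by rewrite /st foldl_rcons.
  have ste w : rcons (st w).1 (s (st w)) = mkseq (fun i => s (st (take i w))) (size w).+1.
    elim/last_ind: w => [//|w u IH]; rewrite mkseqS strcons IH size_rcons.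
    congr rcons; last by rewrite -(size_rcons w u) take_size.
    by apply/eq_in_map => i; rewrite mem_iota /= => ilt; rewrite -cats1 takel_cat// -ltnS.
  exists (fun w => s (st w)) => w Ww; rewrite -ste.
  have win_st : first_wins T W (st w).1 (st w).2.
    elim/last_ind: w Ww => [//|w u IH] Ww.
    have Ww' : W w by have := pW _ (size w) Ww; rewrite -cats1 take_size_cat.
    have [_] := hs _ (IH Ww'); rewrite st2 => /(_ u Ww).
    by rewrite strcons st2.
  exact: (hs _ win_st).1.
left.
have [|s hs] := @choice _ _ (fun (p : seq V * seq U * V) u => ~ first_wins T W p.1.1 p.1.2 ->
    T (rcons p.1.1 p.2) -> W (rcons p.1.2 u) /\ ~ first_wins T W (rcons p.1.1 p.2) (rcons p.1.2 u)).
  move=> [[t w] v]; have [h|h] := pselect (exists u, W (rcons w u) /\ ~ first_wins T W (rcons t v) (rcons w u)).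
    by have [u hu] := h; exists u.
  exists u0 => /= nw Tv; exfalso; apply: nw; apply: FirstWins Tv _ => u Wu.
  by apply: contrapT => nu; apply: h; exists u.
pose step (p : seq V * seq U) v := (rcons p.1 v, rcons p.2 (s (p, v))).
pose st t := foldl step ([::], [::]) t.
have st1 t : (st t).1 = t.
  by elim/last_ind: t => [//|t v IH]; rewrite /st foldl_rcons /= -/(st t) IH.
pose f t := last u0 (st t).2.
have strcons t v : (st (rcons t v)).2 = rcons (st t).2 (f (rcons t v)).
  by rewrite /f /st foldl_rcons /= last_rcons.
have ste t : (st t).2 = mkseq (fun i => f (take i.+1 t)) (size t).
  elim/last_ind: t => [//|t v IH]; rewrite strcons IH size_rcons mkseqS.
  congr rcons; last by rewrite -(size_rcons t v) take_size.
  by apply/eq_in_map => i; rewrite mem_iota /= => ilt; rewrite -cats1 takel_cat.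
exists f => t Tt; rewrite -ste.
suff : W (st t).2 /\ ~ first_wins T W (st t).1 (st t).2 by case.
elim/last_ind: t Tt => [//|t v IH] Tt.
have Tt' : T t by have := pT _ (size t) Tt; rewrite -cats1 take_size_cat.
have [_ /(hs (st t, v))] := IH Tt'; rewrite /= st1 => /(_ Tt).
by rewrite strcons /f /st foldl_rcons /= last_rcons -/(st t) st1.
Qed.

Lemma tree_le_wf (T : seq V -> Prop) (W : seq U -> Prop) :
  tree_le T W -> (exists b : nat -> V, forall n, T (mkseq b n)) ->
  exists b : nat -> U, forall n, W (mkseq b n).
Proof.
move=> [f hf] [b hb]; exists (fun i => f (mkseq b i.+1)) => n.
have := hf _ (hb n); rewrite size_mkseq.
congr W; apply/eq_in_map => i; rewrite mem_iota /= => ilt.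
by congr f; rewrite take_mkseq (minn_idPl ilt).
Qed.

End games.

Lemma tree_le_sub U V (T T' : seq V -> Prop) (W : seq U -> Prop) :
  (forall t, T' t -> T t) -> tree_le T W -> tree_le T' W.
Proof. by move=> h [f hf]; exists f => t /h/hf. Qed.

Section bounded_sections.
Context {X : Type} {cX : Coded X} (D : X * (nat -> bool) -> Prop).
Context (C C' : nat -> (X * (nat -> bool)) * baire -> Prop).
Context (hC : forall n, lcf (C n)) (hC' : forall n, lcf (C' n)).
Context (DC : forall p, D p <-> exists y, forall n, C n (p, y)).
Context (DC' : forall p, ~ D p <-> exists y, forall n, C' n (p, y)).

Notation V := (bool * nat)%type.
Notation U := (bool * nat * seq (seq (bool * nat)))%type.

(* Attempts at building a point [z] of the section [D_x] in the cylinder of [s],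
   together with a witness of membership. *)
Definition section_tree (x : X) (s : seq bool) (t : seq V) : Prop :=
  exists x' (z : nat -> bool) (y : baire),
    [/\ agree (size t) x x', t = mkseq (fun i => (z i, y i)) (size t),
        cyl s z & forall i, (i < size t)%N -> C i ((x', z), y)].

(* Attempts at building a point outside [D_x] (with a witness [u]) which is a
   limit of points of [D_x]; the row [n] of the last components approximates a
   branch of [section_tree x (restr z n)]. *)
Definition limit_tree (x : X) (w : seq U) : Prop :=
  exists x' (z : nat -> bool) (u : baire),
    [/\ agree (size w) x x', map fst w = mkseq (fun i => (z i, u i)) (size w),
        forall i, (i < size w)%N -> C' i ((x', z), u) &
        forall k n, (k < size w)%N -> (n < k)%N ->
          let row j := nth [::] (nth (false, 0%N, [::]) w j).2 n in
          [/\ size (row k) = k, section_tree x (restr z n) (row k) &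
              forall k', (k' <= k)%N -> (n < k')%N -> row k' = take k' (row k)]].

Definition section_closed x := forall z, (forall n, exists2 z', D (x, z') & cyl (restr z n) z') -> D (x, z).

Definition section_prefixes x (s : seq bool) := exists2 z, D (x, z) & cyl s z.

Lemma section_tree_prefix x s : prefix_closed (section_tree x s).
Proof.
move=> t n [x' [z [y [h1 h2 h3 h4]]]].
have nt : (size (take n t) <= size t)%N by rewrite size_take; case: ltnP => // /ltnW.
exists x', z, y; split=> //.
- exact: agree_le h1.
- by rewrite [in LHS]h2 take_mkseq -size_take_min.
- by move=> i ilt; apply: h4; exact: leq_trans nt.
Qed.

Lemma limit_tree_prefix x : prefix_closed (limit_tree x).
Proof.
move=> w n [x' [z [u [h1 h2 h3 h4]]]].
have nw : (size (take n w) <= size w)%N by rewrite size_take; case: ltnP => // /ltnW.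
have nn : (size (take n w) <= n)%N by rewrite size_take_min geq_minl.
exists x', z, u; split=> //.
- exact: agree_le h1.
- by rewrite map_take h2 take_mkseq -size_take_min.
- by move=> i ilt; apply: h3; exact: leq_trans nw.
- move=> k m kw mk row; have [e1 e2 e3] := h4 k m (leq_trans kw nw) mk.
  have e j : (j <= k)%N -> row j = nth [::] (nth (false, 0%N, [::]) w j).2 m.
    by move=> jk; rewrite /row nth_take ?(leq_trans (leq_ltn_trans jk kw) nn).
  rewrite (e k (leqnn k)); split; [exact: e1|exact: e2|].
  by move=> k' k'k mk'; rewrite (e k' k'k); exact: e3.
Qed.

(** This is why the trees speak of some [x'] agreeing with [x] on finitely many coordinates and not
    of [x] itself. *)
Lemma lcf_section_tree s t : lcf (fun x => section_tree x s t).
Proof.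
apply: (@lcf_agree _ _ _ _ (size t)) => x x' xx'; apply/propext.
split=> -[x1 [z [y [h1 h2 h3 h4]]]]; exists x1, z, y; split=> //.
  exact: agree_trans xx' h1.
exact: agree_trans (agree_sym xx') h1.
Qed.

Lemma lcf_limit_tree w : lcf (fun x => limit_tree x w).
Proof.
apply: (@lcf_agree _ _ _ _ (size w)) => x x' xx'; apply/propext.
have sec x1 x2 s t : (size t <= size w)%N -> agree (size w) x1 x2 ->
    section_tree x1 s t -> section_tree x2 s t.
  move=> tw x12 [x3 [z [y [h1 h2 h3 h4]]]]; exists x3, z, y; split=> //.
  by apply: agree_trans h1; apply: agree_sym; exact: agree_le x12.
split=> -[x1 [z [u [h1 h2 h3 h4]]]]; exists x1, z, u; split=> //.
- exact: agree_trans xx' h1.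
- move=> k n kw nk; have [e1 e2 e3] := h4 k n kw nk; split=> //.
  by apply: sec (agree_sym xx') e2; rewrite e1 ltnW.
- exact: agree_trans (agree_sym xx') h1.
- move=> k n kw nk; have [e1 e2 e3] := h4 k n kw nk; split=> //.
  by apply: sec xx' e2; rewrite e1 ltnW.
Qed.

(** A branch of these trees only provides approximations to the intended point; a clopen condition
    that they satisfy passes to the limit. *)
Lemma eventually_exact (E : (X * (nat -> bool)) * baire -> Prop) x z y (i : nat) : lcf E ->
  (forall n, exists x' z' y', [/\ agree n x x',
     forall j, (j < n)%N -> z' j = z j, forall j, (j < n)%N -> y' j = y j &
     (i < n)%N -> E ((x', z'), y')]) -> E ((x, z), y).
Proof.
move=> hE h; have [m hm] := hE ((x, z), y).
have [n1 hn1] := @agree_seq bool m; have [n2 hn2] := @agree_seq nat m.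
pose n := maxn (maxn n1 n2) (maxn m i.+1).
have [x' [z' [y' [ex ez ey Ei]]]] := h n.
rewrite -(hm ((x', z'), y')); first by apply: Ei; lia.
apply: agree_pair; first apply: agree_pair.
- by apply: agree_le ex; lia.
- by apply: hn1 => j jn; rewrite ez//; lia.
- by apply: hn2 => j jn; rewrite ey//; lia.
Qed.

Lemma section_tree_branch x s :
  (exists b : nat -> V, forall n, section_tree x s (mkseq b n)) <-> section_prefixes x s.
Proof.
split=> [[b hb]|[z /DC[y hy] sz]]; last first.
  exists (fun i => (z i, y i)) => n; exists x, z, y; split=> //; rewrite ?size_mkseq//.
have hb' n : exists x' z' y', [/\ agree n x x', forall j, (j < n)%N -> z' j = (b j).1,
     forall j, (j < n)%N -> y' j = (b j).2, cyl s z' & forall i, (i < n)%N -> C i ((x', z'), y')].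
  have [x' [z' [y' [h1 h2 h3 h4]]]] := hb n; rewrite size_mkseq in h1 h2 h4.
  have e j : (j < n)%N -> b j = (z' j, y' j).
    by move=> jn; have := congr1 (fun l => nth (false, 0%N) l j) h2; rewrite !nth_mkseq.
  by exists x', z', y'; split=> // j /e->.
exists (fun i => (b i).1).
  apply/DC; exists (fun i => (b i).2) => i; apply: (@eventually_exact _ _ _ _ i (hC i)).
  move=> n; have [x' [z' [y' [h1 h2 h3 h4 h5]]]] := hb' n.
  by exists x', z', y'; split=> // ?; exact: h5.
have [x' [z' [y' [_ h2 _ h4 _]]]] := hb' (size s).
by move=> i ilt; rewrite -h2// h4.
Qed.

(** A branch would consist of a point outside [D_x] and, in row [n], of a point of [D_x] sharing its
    first [n] bits, against closedness. *)
Lemma limit_tree_wf x : section_closed x ->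
  ~ exists b : nat -> U, forall n, limit_tree x (mkseq b n).
Proof.
move=> cx [b hb].
have hb' n : exists x' z u, [/\ agree n x x', forall j, (j < n)%N -> z j = (b j).1.1,
     forall j, (j < n)%N -> u j = (b j).1.2, forall i, (i < n)%N -> C' i ((x', z), u) &
     forall k m, (k < n)%N -> (m < k)%N ->
      let row j := nth [::] (b j).2 m in
          [/\ size (row k) = k, section_tree x (restr z m) (row k) &
              forall k', (k' <= k)%N -> (m < k')%N -> row k' = take k' (row k)]].
  have [x' [z [u [h1 h2 h3 h4]]]] := hb n; rewrite size_mkseq in h1 h2 h3 h4.
  have e j : (j < n)%N -> (b j).1 = (z j, u j).
    move=> jn; have := congr1 (fun l => nth (false, 0%N) l j) h2.
    by rewrite /mkseq -map_comp !nth_mkseq.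
  exists x', z, u; split=> //; try by move=> j /e->.
  move=> k m kn mk; have [e1 e2 e3] := h4 k m kn mk.
  rewrite nth_mkseq// in e1 e2 e3; split=> // k' k'k mk'.
  by have := e3 k' k'k mk'; rewrite nth_mkseq ?(leq_ltn_trans k'k).
pose z i := (b i).1.1; pose u i := (b i).1.2.
have nD : ~ D (x, z).
  apply/DC'; exists u => i; apply: (@eventually_exact _ _ _ _ i (hC' i)).
  move=> n; have [x' [z' [u' [h1 h2 h3 h4 _]]]] := hb' n.
  by exists x', z', u'; split=> // ?; exact: h4.
apply/nD/cx => n.
suff : section_prefixes x (restr z n) by [].
apply/section_tree_branch.
(* Row [n] is constrained only at stages [k > n], where it has [k] entries; entry [i] is therefore
   read at a stage exceeding both [i] and [n]. *)
exists (fun i => nth (false, 0%N) (nth [::] (b (maxn i n).+1).2 n) i) => m.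
have [x' [z' [u' [_ hz _ _ h]]]] := hb' (maxn m n).+2.
have [e1 e2 e3] := h (maxn m n).+1 n ltac:(lia) ltac:(lia).
rewrite (_ : restr z n = restr z' n); last first.
  by apply: restr_eq => i ilt; rewrite hz//; lia.
rewrite (_ : mkseq _ _ = take m (nth [::] (b (maxn m n).+1).2 n)).
  exact: section_tree_prefix.
have em : (m <= size (nth [::] (b (maxn m n).+1).2 n))%N by rewrite e1; lia.
apply: (@eq_from_nth _ (false, 0%N)); rewrite size_mkseq ?size_takel// => i im.
rewrite nth_mkseq// nth_take// [in LHS]e3; [|lia|lia].
by rewrite nth_take//; lia.
Qed.

(* If the first player won every game on [limit_tree] and
   [section_tree x (restr z n)], playing these strategies against each other
   would produce a branch of [limit_tree]. *)
Lemma section_tree_bounded x z : section_closed x -> ~ D (x, z) ->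
  exists n, tree_le (section_tree x (restr z n)) (limit_tree x).
Proof.
move=> cx nDz; apply: contrapT => /forallNP nle; apply: (limit_tree_wf cx).
have W0 : limit_tree x [::] by exists x, z, id; split.
have /choice[g hg] n : exists g : seq U -> V, forall w, limit_tree x w ->
    section_tree x (restr z n) (mkseq (fun i => g (take i w)) (size w).+1).
  have [/nle//|//] := tree_compare (false, 0%N, [::]) (false, 0%N)
    (@section_tree_prefix x (restr z n)) (@limit_tree_prefix x) W0.
have [u hu] := (DC' _).1 nDz.
(* The first [size p] moves of the strategy [g n] against the play [p]. *)
pose row (p : seq U) n := mkseq (fun i => g n (take i p)) (size p).
pose fix b k := if k is k'.+1 then rcons (b k') (z k', u k', mkseq (row (b k')) k') else [::].
have sb k : size (b k) = k by elim: k => [//|k IH] /=; rewrite size_rcons IH.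
have tb i k : (i <= k)%N -> take i (b k) = b i.
  elim: k => [|k IH]; first by rewrite leqn0 => /eqP ->.
  rewrite leq_eqVlt => /orP[/eqP->|]; first by rewrite -{1}(sb k.+1) take_size.
  by rewrite ltnS => ik; rewrite /= -cats1 takel_cat ?sb// IH.
pose bb k := (z k, u k, mkseq (row (b k)) k).
have bE k : b k = mkseq bb k by elim: k => [//|k IH]; rewrite mkseqS -IH.
have rowE k n : (n < k)%N -> nth [::] (bb k).2 n = mkseq (fun i => g n (b i)) k.
  move=> nk; rewrite /= nth_mkseq// /row sb; apply/eq_in_map => i.
  by rewrite mem_iota => /= ik; rewrite tb// ltnW.
exists bb => n; rewrite -bE; elim/ltn_ind: n => n IH.
exists x, z, u; split=> //.
- by rewrite sb bE /mkseq -map_comp.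
- rewrite sb => k m kn mk /=.
  have e j : (j <= k)%N -> (m < j)%N -> nth [::] (nth (false, 0%N, [::]) (b n) j).2 m = mkseq (fun i => g m (b i)) j.
    by move=> jk mj; rewrite bE nth_mkseq ?rowE// (leq_ltn_trans jk).
  split; rewrite ?e ?size_mkseq//; last by move=> k' k'k mk'; rewrite !e// take_mkseq (minn_idPl k'k).
  (* Against a play of length [k] the strategy makes [k.+1] moves, so the row at stage [k.+1] only
     relies on the induction hypothesis at [k]. *)
  case: k kn mk e => // k kn mk e.
  have := hg m _ (IH k (ltnW kn)); rewrite sb; congr section_tree.
  by apply/eq_in_map => i; rewrite mem_iota => /= ik; rewrite tb.
Qed.

End bounded_sections.


Lemma Ana_tree_le {X : Type} {cX : Coded X} (U V : countType) (u0 : U)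
  (T : X -> seq V -> Prop) (W : X -> seq U -> Prop) :
  (forall t, lcf (fun x => T x t)) -> (forall w, lcf (fun x => W x w)) ->
  Ana (fun x => tree_le (T x) (W x)).
Proof.
move=> hT hW; apply: (Ana_ex u0 (P := fun p : X * (seq V -> U) => forall t, T p.1 t ->
  W p.1 (mkseq (fun i => p.2 (take i.+1 t)) (size t)))).
apply: Ana_forall => t; apply: Ana_lcf.
apply: (lcf_map2 (fun P Q : Prop => P -> Q)); first exact: lcf_comp (hT t) cts_fst.
apply: (lcf_case (f := fun p : X * (seq V -> U) => mkseq (fun i => p.2 (take i.+1 t)) (size t))
  (F := fun w p => W p.1 w)).
  by apply: lcf_mkseq => i; apply: (lcf_at (phi := snd)) cts_snd.
by move=> w; exact: lcf_comp (hW w) cts_fst.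
Qed.

Lemma Bi_cyl {X : Type} {cX : Coded X} (phi : X -> nat -> bool) s :
  cts phi -> Bi (fun x => cyl s (phi x)).
Proof.
move=> cp; apply: Bi_forall => i; apply: Bi_imp_const; apply: Bi_lcf.
by apply: (lcf_map (fun b : bool => b = nth false s i)); exact: lcf_at.
Qed.

Lemma Ana_section_prefixes {X : Type} {cX : Coded X} (D : X * (nat -> bool) -> Prop) s :
  Ana D -> Ana (fun x => section_prefixes D x s).
Proof.
move=> aD; apply: (@Ana_ext _ _ (fun x => exists z, D (x, z) /\ cyl s z)).
  by move=> x; split=> -[z]; [move=> []; exists z|exists z].
apply: (Ana_ex false (P := fun p => D p /\ cyl s p.2)).
by apply: Ana_and => //; apply: (Bi_cyl s cts_snd).1.
Qed.

(* Given that [D_x] is closed, its tree [T] is pinned down both by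
   [section_prefixes] and by the trees [section_tree] being dominated by
   [limit_tree], so a coanalytic condition on [T] may be quantified
   existentially over [T]. *)
Lemma coanalytic_closed_sections {X : Type} {cX : Coded X}
  (D : X * (nat -> bool) -> Prop) (Q : (seq bool -> bool) -> Prop) :
  Bi D -> Ana (fun a => ~ Q a) ->
  Ana (fun x : X => ~ (section_closed D x /\ Q (fun s => `[< section_prefixes D x s >]))).
Proof.
move=> [aD aD'] aQ; have [C [hC DC]] := aD; have [C' [hC' DC']] := aD'.
(* Domination is available along each single point outside [D_x]; [fan] makes the level uniform,
   whence the detour through all extensions by [n] bits. *)
pose bounded (x : X) (s : seq bool) := exists n, forall s', size s' = n ->
  tree_le (@section_tree X cX C x (s ++ s')) (@limit_tree X cX C C' x).
apply: (@Ana_ext X cX (fun x => (exists z : nat -> bool, ~ D (x, z) /\ forall n, section_prefixes D x (restr z n)) \/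
  exists a : seq bool -> bool, ((forall s, (a s -> section_prefixes D x s) /\ (~ a s -> bounded x s)) /\ ~ Q a))); last first.
  apply: Ana_or.
    apply: (Ana_ex false (P := fun p => ~ D p /\ forall n, section_prefixes D p.1 (restr p.2 n))).
    apply: Ana_and => //; apply: Ana_forall => n.
    apply: (@Ana_ext _ _ (fun p => exists s, restr p.2 n = s /\ section_prefixes D p.1 s)).
      by move=> p; split=> [[s [-> //]]|h]; exists (restr p.2 n).
    apply: Ana_exists => s; apply: Ana_and.
      apply: Ana_lcf; apply: (lcf_map (fun t => t = s)).
      by apply: lcf_mkseq => i; apply: (lcf_at (phi := snd)) cts_snd.
    exact: Ana_comp (Ana_section_prefixes s aD) cts_fst.
  apply: (Ana_ex false (P := fun p : X * (seq bool -> bool) => (forall s, (p.2 s -> section_prefixes D p.1 s) /\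
    (~ p.2 s -> bounded p.1 s)) /\ ~ Q p.2)).
  apply: Ana_and; last exact: Ana_comp aQ cts_snd.
  apply: Ana_forall => s.
  have ls : lcf (fun p : X * (seq bool -> bool) => p.2 s) by apply: (lcf_at (phi := snd)) cts_snd.
  apply: Ana_and.
    apply: (@Ana_ext _ _ (fun p : X * (seq bool -> bool) => ~ p.2 s \/ section_prefixes D p.1 s)).
      by move=> p; rewrite implyE.
    apply: Ana_or; first by apply: Ana_lcf; apply: (lcf_map (fun b : bool => ~ b)).
    exact: Ana_comp (Ana_section_prefixes s aD) cts_fst.
  apply: (@Ana_ext _ _ (fun p : X * (seq bool -> bool) => p.2 s \/ bounded p.1 s)).
    move=> p; split=> [[? //|//]|h]; case: (boolP (p.2 s)) => [|/negP]; first by left.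
    by move/h; right.
  apply: Ana_or; first by apply: Ana_lcf; apply: (lcf_map (fun b : bool => is_true b)).
  apply: Ana_exists => n; apply: Ana_forall => s'; apply: Ana_imp_const => _.
  apply: (Ana_comp (phi := fst) (P := fun x => tree_le (section_tree C x (s ++ s')) (limit_tree C C' x))); last exact: cts_fst.
  apply: (@Ana_tree_le _ _ _ _ (false, 0%N, [::])) => w.
    exact: lcf_section_tree.
  exact: lcf_limit_tree.
move=> x; split.
  move=> [[z [nD hz]] [cD _]|[a [ha nQ]] [cD Qt]]; first exact/nD/cD.
  apply: nQ; rewrite (_ : a = fun s => `[< section_prefixes D x s >])//.
  apply/funext => s; apply/idP/asboolP; first exact: (ha s).1.
  move=> [z Dz sz]; apply/negPn/negP => /negP/(ha s).2[n hn].
  apply: (limit_tree_wf hC hC' DC DC' cD).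
  apply: tree_le_wf (hn (restr (tail (size s) z) n) (size_restr _ _)) _.
  apply/(section_tree_branch hC DC); exists z => //.
  by rewrite -restr_app app_tail//; exact: cyl_restr_self.
move=> nh; have [cD|ncD] := pselect (section_closed D x); last first.
  have /existsNP[z /not_implyP[hz nD]] := ncD.
  left; exists z; split; first exact: nD.
  move=> n; by have [z' h1 h2] := hz n; exists z'.
right; exists (fun s => `[< section_prefixes D x s >]); split; last by move=> Qt; apply: nh.
move=> s; split; first by move/asboolP.
move=> nts; have ns : ~ section_prefixes D x s by move=> h; apply/nts/asboolP.
have sub s1 t t' : section_tree C x (s1 ++ t) t' -> section_tree C x s1 t'.
  by move=> [x' [z [y [h1 h2 h3 h4]]]]; exists x', z, y; split=> //; exact: cyl_cat h3.
apply: (@fan (fun s' => tree_le (section_tree C x (s ++ s')) (limit_tree C C' x))).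
  by move=> s1 t; apply: tree_le_sub => t'; rewrite catA; exact: sub.
move=> z; have nD : ~ D (x, app s z).
  by move=> Dz; apply: ns; exists (app s z) => //; exact: cyl_app.
have [n hn] := section_tree_bounded hC hC' DC DC' cD nD; exists n.
apply: tree_le_sub hn => t'; rewrite -restr_app.
rewrite -(cat_take_drop n (restr (app s z) (size s + n))) take_restr ?leq_addl//.
exact: sub.
Qed.

(** * Homeomorphism classes of closed sets *)

Definition homeo (A B : set cantor_space) (f g : cantor_space -> cantor_space) :=
  [/\ {within A, continuous f} /\ {within B, continuous g},
      f @` A `<=` B, g @` B `<=` A,
      (forall x, A x -> g (f x) = x) & (forall y, B y -> f (g y) = y)].

Lemma homeo_sym A B f g : homeo A B f g -> homeo B A g f.
Proof. by move=> [[? ?] ? ? ? ?]; split. Qed.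

Lemma homeo_trans A B C f g f' g' : homeo A B f g -> homeo B C f' g' ->
  homeo A C (f' \o f) (g \o g').
Proof.
move=> [[/continuous_within_cantorP cf /continuous_within_cantorP cg] fA gB gf fg]
  [[/continuous_within_cantorP cf' /continuous_within_cantorP cg'] fB gC gf' fg'].
have mA x : A x -> B (f x) by move=> Ax; apply: fA; exists x.
have mB x : B x -> C (f' x) by move=> Bx; apply: fB; exists x.
have mC x : C x -> B (g' x) by move=> Cx; apply: gC; exists x.
have mB' x : B x -> A (g x) by move=> Bx; apply: gB; exists x.
split.
- split; apply/continuous_within_cantorP => x n hx /=.
    have [m hm] := cf' _ n (mA _ hx); have [k hk] := cf _ m hx.
    by exists k => y Ay ky; apply: hm; [exact: mA|exact: hk].
  have [m hm] := cg _ n (mC _ hx); have [k hk] := cg' _ m hx.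
  by exists k => y Ay ky; apply: hm; [exact: mC|exact: hk].
- by move=> _ [x Ax <-]; apply/mB/mA.
- by move=> _ [x Ax <-]; apply/mB'/mC.
- by move=> x Ax /=; rewrite gf' ?gf//; exact: mA.
- by move=> x Ax /=; rewrite fg ?fg'//; exact: mC.
Qed.

Lemma continuous_within_local (A : set cantor_space) (f : cantor_space -> cantor_space) :
  (forall i, exists m, forall x y : cantor_space,
     (forall j, (j < m)%N -> x j = y j) -> f x i = f y i) ->
  {within A, continuous f}.
Proof.
move=> /choice[m hm]; apply/continuous_within_cantorP => x n _.
exists (\max_(i < n) m i) => y _ /cyl_restr xy; apply/cyl_restr => i ilt.
apply: hm => j jm; apply: xy; apply: leq_trans jm _.
exact: (@leq_bigmax _ (fun i : 'I_n => m i) (Ordinal ilt)).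
Qed.

Fixpoint strings n : seq (seq bool) :=
  if n is n'.+1 then map (cons true) (strings n') ++ map (cons false) (strings n')
  else [:: [::]].

Lemma mem_strings n s : (s \in strings n) = (size s == n).
Proof.
elim: n s => [|n IH] [|b s] //=.
  by rewrite mem_cat; apply/negP => /orP[] /mapP[].
rewrite mem_cat eqSS -IH; apply/orP/idP => [[/mapP[t h [_ ->]]|/mapP[t h [_ ->]]]|h] //.
by case: b; [left|right]; apply: map_f.
Qed.

(* A code [(n, l)] stands for the clopen set of the points [x] whose prefix of
   length [n] is in [l]. *)
Notation clopen_code := (nat * seq (seq bool))%type.

Definition in_code (a : clopen_code) (x : cantor_space) : bool := restr x a.1 \in a.2.
Definition in_code_prefix (a : clopen_code) (s : seq bool) : bool := take a.1 s \in a.2.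

Definition bit_code i : clopen_code := (i.+1, [seq s <- strings i.+1 | nth false s i]).

Lemma in_bit_code i x : in_code (bit_code i) x = x i.
Proof. by rewrite /in_code mem_filter mem_strings size_restr eqxx andbT nth_mkseq. Qed.

Lemma in_code_restr a x N : (a.1 <= N)%N -> in_code_prefix a (restr x N) = in_code a x.
Proof. by move=> aN; rewrite /in_code_prefix take_restr. Qed.

Lemma in_code_eq a x y : (forall j, (j < a.1)%N -> x j = y j) -> in_code a x = in_code a y.
Proof. by move=> h; rewrite /in_code (restr_eq h). Qed.

Definition code_bound (c : seq (clopen_code * clopen_code)) : nat :=
  \max_(p <- c) maxn p.1.1 p.2.1.

Lemma code_boundP c p : p \in c -> (p.1.1 <= code_bound c)%N /\ (p.2.1 <= code_bound c)%N.
Proof.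
move=> pc; have h : (maxn p.1.1 p.2.1 <= code_bound c)%N by rewrite /code_bound (big_rem p pc) /= leq_maxl.
by split; apply: leq_trans h; rewrite ?leq_maxl ?leq_maxr.
Qed.

Definition matches (A : set cantor_space) (f : cantor_space -> cantor_space)
    (c : seq (clopen_code * clopen_code)) :=
  forall p x, p \in c -> A x -> in_code p.1 x = in_code p.2 (f x).

(** The preimage of a clopen set under [g] is relatively clopen in [B], and compactness of [B] lets
    strings of one length cut it out. *)
Lemma code_transport A B f g a : closed B -> homeo A B f g ->
  exists b, forall y, B y -> in_code b y = in_code a (g y).
Proof.
move=> cB [[_ /continuous_within_cantorP cg] _ gB _ _].
have [||n hn] := @fan (fun s => forall y y', B y -> B y' -> cyl s y -> cyl s y' -> in_code a (g y) = in_code a (g y')).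
- by move=> s t h y y' By By' /cyl_cat sy /cyl_cat sy'; exact: h.
- move=> x; have [Bx|nBx] := pselect (B x).
    have [m hm] := cg x a.1 Bx; exists m => y y' By By' xy xy'.
    have /cyl_restr h1 := hm _ By xy; have /cyl_restr h2 := hm _ By' xy'.
    by apply: in_code_eq => j ja; rewrite h1 ?h2.
  have [n hn] := closed_avoid cB nBx.
  by exists n => y y' /hn nxy _ /nxy.
exists (n, [seq s <- strings n | `[< exists y, [/\ B y, cyl s y & in_code a (g y)] >]]) => y By.
rewrite /in_code mem_filter mem_strings size_restr eqxx andbT -/(in_code a (g y)).
apply/asboolP/idP => [[y' [By' yy' ay']]|ay].
  by rewrite (hn (restr y n) _ y y')// ?size_restr//; exact: cyl_restr_self.
by exists y; split=> //; exact: cyl_restr_self.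
Qed.

Section back_and_forth.
Context (H : set cantor_space) (cH : closed H).

(** The orbit relation of the homeomorphisms of [H] acting on left components. It relates countably
    many lists and depends on [H] alone, so the quantifier over maps costs nothing in complexity. *)
Definition orbit_equiv (c c' : seq (clopen_code * clopen_code)) :=
  unzip2 c = unzip2 c' /\
  exists f g, homeo H H f g /\ matches H f (zip (unzip1 c') (unzip1 c)).

(** A finite shadow of matching: at length [code_bound c] strings decide every code in [c], so only
    strings are quantified over, not points. *)
Definition consistent (a : seq bool -> bool) (c : seq (clopen_code * clopen_code)) :=
  (forall s, tree H s /\ size s = code_bound c -> exists t,
      a t /\ (size t = code_bound c /\
      forall p, p \in c -> in_code_prefix p.1 s = in_code_prefix p.2 t)) /\
  (forall t, a t -> size t = code_bound c -> exists s, [/\ tree H s, size s = code_bound c &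
      forall p, p \in c -> in_code_prefix p.1 s = in_code_prefix p.2 t]).

(* [Z] consists of the finite sets of pairs of clopen sets which are matched by
   some homeomorphism between [H] and the set with tree [a]; closure under the
   homeomorphisms of [H] makes [Z] unique. *)
Definition back_and_forth (a : seq bool -> bool) (Z : seq (clopen_code * clopen_code) -> Prop) :=
  [/\ Z [::],
      (forall c p, Z c -> exists q, Z ((p, q) :: c)),
      (forall c q, Z c -> exists p, Z ((p, q) :: c)),
      (forall c, Z c -> consistent a c) &
      (forall c c', Z c -> orbit_equiv c c' -> Z c')].

Context (L : set cantor_space) (cL : closed L).

Lemma homeo_back_and_forth f0 g0 : homeo H L f0 g0 ->
  back_and_forth (tree L) (fun c => exists f g, homeo H L f g /\ matches H f c).
Proof.
move=> h0; split.
- by exists f0, g0; split.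
- move=> c p [f [g [hfg mf]]]; have [q hq] := code_transport p cL hfg.
  exists q, f, g; split=> // -[p' q'] x; rewrite in_cons => /orP[/eqP[-> ->]|]; last exact: mf.
  have [_ fH _ gf _] := hfg.
  by move=> Hx /=; rewrite hq ?gf//; apply: fH; exists x.
- move=> c q [f [g [hfg mf]]]; have [p hp] := code_transport q cH (homeo_sym hfg).
  exists p, f, g; split=> // -[p' q'] x; rewrite in_cons => /orP[/eqP[-> ->]|]; last exact: mf.
  by move=> Hx; exact: hp.
- move=> c [f [g [hfg mf]]]; have [_ fH gL gf fg] := hfg; split.
    move=> s [/asboolP[x [Hx sx]] ss].
    exists (restr (f x) (code_bound c)); split; last split.
    + by apply/asboolP; exists (f x); split; [apply: fH; exists x|exact: cyl_restr_self].
    + exact: size_restr.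
    + move=> p pc; have [b1 b2] := code_boundP pc; rewrite in_code_restr// -(mf p x)//.
      by rewrite -((cylP s x).1 sx) ss in_code_restr.
  move=> t /asboolP[y [Ly ty]] st.
  exists (restr (g y) (code_bound c)); split.
  + by apply/asboolP; exists (g y); split; [apply: gL; exists y|exact: cyl_restr_self].
  + exact: size_restr.
  + move=> p pc; have [b1 b2] := code_boundP pc; rewrite in_code_restr// (mf p (g y))// ?fg//.
      by rewrite -((cylP t y).1 ty) st in_code_restr.
    by apply: gL; exists y.
- move=> c c' [f [g [hfg mf]]] [e [f1 [g1 [h1 m1]]]].
  exists (f \o f1), (g1 \o g); split; first exact: homeo_trans h1 hfg.
  move=> p x /(nthP p)[i ilt <-] Hx.
  have sz : size c = size c' by rewrite -(size_map snd c) -/(unzip2 c) e size_map.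
  have [_ fH _ _ _] := h1.
  have ez : nth (p.1, p.1) (zip (unzip1 c') (unzip1 c)) i = ((nth p c' i).1, (nth p c i).1).
    by rewrite nth_zip ?size_map ?sz// !(nth_map p) ?sz.
  have := m1 ((nth p c' i).1, (nth p c i).1) x.
  rewrite -{1}ez mem_nth ?size_zip ?size_map ?sz ?minnn// => /(_ isT Hx)/= ->.
  have -> : (nth p c' i).2 = (nth p c i).2.
    by rewrite -!(nth_map p p.2 snd) ?sz// -/(unzip2 c') -/(unzip2 c) e.
  by apply: mf; [rewrite mem_nth ?sz|apply: fH; exists x].
Qed.

(** A chain of lists in [Z] above [c0] gives every code a partner on either side. The partners of
    the sets where bit [i] is true define bit [i] of the two maps. *)
Lemma back_and_forth_homeo Z c0 : back_and_forth (tree L) Z -> Z c0 ->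
  exists f g, homeo H L f g /\ matches H f c0.
Proof.
move=> [_ forth back cons _] Zc0.
have [|e1 he1] := @choice _ _ (fun (cp : seq (clopen_code * clopen_code) * clopen_code) q => Z cp.1 -> Z ((cp.2, q) :: cp.1)).
  move=> [c p]; have [Zc|nZ] := pselect (Z c); last by exists p.
  by have [q hq] := forth c p Zc; exists q.
have [|e2 he2] := @choice _ _ (fun (cq : seq (clopen_code * clopen_code) * clopen_code) p => Z cq.1 -> Z ((p, cq.2) :: cq.1)).
  move=> [c q]; have [Zc|nZ] := pselect (Z c); last by exists q.
  by have [p hp] := back c q Zc; exists p.
pose pt n : clopen_code := odflt (0%N, [::]) (unpickle n).
pose half (c : seq (clopen_code * clopen_code)) p := (p, e1 (c, p)) :: c.
pose step c p := (e2 (half c p, p), p) :: half c p.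
pose fix ch n := if n is n'.+1 then step (ch n') (pt n') else c0.
have Zch n : Z (ch n).
  by elim: n => [//|n IH] /=; apply: (he2 (half (ch n) (pt n), pt n)); apply: (he1 (ch n, pt n)).
have chS n m : (n <= m)%N -> {subset ch n <= ch m}.
  move=> /subnKC <- p; elim: (m - n)%N => [|k IH]; first by rewrite addn0.
  by rewrite addnS /= => /IH h; rewrite !in_cons h !orbT.
pose br i := e2 (half (ch (pickle (bit_code i))) (bit_code i), bit_code i).
pose fr i := e1 (ch (pickle (bit_code i)), bit_code i).
have brP i : (br i, bit_code i) \in ch (pickle (bit_code i)).+1.
  by rewrite /= /pt pickleK /= in_cons eqxx.
have frP i : (bit_code i, fr i) \in ch (pickle (bit_code i)).+1.
  by rewrite /= /pt pickleK /= !in_cons eqxx orbT.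
pose N m := \max_(i < m) (pickle (bit_code i)).+1.
have brN i m : (i < m)%N -> ((br i, bit_code i) \in ch (N m)) && ((bit_code i, fr i) \in ch (N m)).
  move=> im; have h : ((pickle (bit_code i)).+1 <= N m)%N.
    exact: (@leq_bigmax _ (fun i : 'I_m => (pickle (bit_code i)).+1) (Ordinal im)).
  by rewrite !(chS _ _ h).
pose f (x : cantor_space) : cantor_space := fun i => in_code (br i) x.
pose g (y : cantor_space) : cantor_space := fun i => in_code (fr i) y.
(* Consistency only supplies points of [L] approximating [f x] and matched with [x]; closedness of
   [L] and finiteness of codes then transfer this to [f x]. *)
have fap x m n : H x -> exists y, [/\ L y, forall i, (i < m)%N -> y i = f x i &
    forall p, p \in ch n -> in_code p.1 x = in_code p.2 y].
  move=> Hx; set k := maxn n (N m); have [h _] := cons _ (Zch k).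
  have [|t [/asboolP[y [Ly ty]] [st ht]]] := h (restr x (code_bound (ch k))).
    split; last exact: size_restr.
    by apply/asboolP; exists x; split=> //; exact: cyl_restr_self.
  have match_k p : p \in ch k -> in_code p.1 x = in_code p.2 y.
    move=> pc; have [b1 b2] := code_boundP pc; have := ht _ pc.
    by rewrite in_code_restr// => ->; rewrite -((cylP t y).1 ty) st in_code_restr.
  exists y; split=> //.
    move=> i im; rewrite -(in_bit_code i y) -(match_k (br i, bit_code i))//.
    by apply: (chS (N m)); [exact: leq_maxr|have /andP[] := brN _ _ im].
  by move=> p pn; apply: match_k; apply: (chS n) => //; exact: leq_maxl.
have gap y m n : L y -> exists x, [/\ H x, forall i, (i < m)%N -> x i = g y i &
    forall p, p \in ch n -> in_code p.1 x = in_code p.2 y].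
  move=> Ly; set k := maxn n (N m); have [_ h] := cons _ (Zch k).
  have [||s [/asboolP[x [Hx sx]] ss hs]] := h (restr y (code_bound (ch k))).
    by apply/asboolP; exists y; split=> //; exact: cyl_restr_self.
    exact: size_restr.
  have match_k p : p \in ch k -> in_code p.1 x = in_code p.2 y.
    move=> pc; have [b1 b2] := code_boundP pc; have := hs _ pc.
    by rewrite in_code_restr// => <-; rewrite -((cylP s x).1 sx) ss in_code_restr.
  exists x; split=> //.
    move=> i im; rewrite -(in_bit_code i x) (match_k (bit_code i, fr i))//.
    by apply: (chS (N m)); [exact: leq_maxr|have /andP[] := brN _ _ im].
  by move=> p pn; apply: match_k; apply: (chS n) => //; exact: leq_maxl.
have fL x : H x -> L (f x).
  move=> Hx; move/closed_cantorP: cL; apply=> m.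
  by have [y [Ly hy _]] := fap x m 0%N Hx; exists y => //; apply/cyl_restr.
have gH y : L y -> H (g y).
  move=> Ly; move/closed_cantorP: cH; apply=> m.
  by have [x [Hx hx _]] := gap y m 0%N Ly; exists x => //; apply/cyl_restr.
have fm n p x : p \in ch n -> H x -> in_code p.1 x = in_code p.2 (f x).
  move=> pn Hx; have [y [_ hy /(_ p pn) ->]] := fap x p.2.1 n Hx.
  exact: in_code_eq.
have gm n p y : p \in ch n -> L y -> in_code p.1 (g y) = in_code p.2 y.
  move=> pn Ly; have [x [_ hx /(_ p pn) <-]] := gap y p.1.1 n Ly.
  by apply: in_code_eq => j jp; rewrite hx.
exists f, g; split; last by move=> p x pc Hx; exact: (fm 0%N).
split.
- split; apply: continuous_within_local => i.
    by exists (br i).1 => x y xy; exact: in_code_eq.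
  by exists (fr i).1 => x y xy; exact: in_code_eq.
- by move=> _ [x Hx <-]; exact: fL.
- by move=> _ [x Hx <-]; exact: gH.
- by move=> x Hx; apply/funext => i; rewrite /g -(fm _ _ _ (frP i) Hx) in_bit_code.
- by move=> y Ly; apply/funext => i; rewrite /f (gm _ _ _ (brP i) Ly) in_bit_code.
Qed.

Lemma back_and_forth_total a Z (c : seq (clopen_code * clopen_code)) : back_and_forth a Z ->
  exists c', unzip2 c' = unzip2 c /\ Z c'.
Proof.
move=> [Z0 _ back _ _]; elim: c => [|[p q] c [c' [e Zc']]]; first by exists [::].
by have [p' hp'] := back c' q Zc'; exists ((p', q) :: c'); rewrite /= e.
Qed.

(** [Z'] contains a list with the right components of [c]. Homeomorphisms realizing the two lists
    differ by one of [H], which carries the left components across, and saturation of [Z']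
    applies. *)
Lemma back_and_forth_unique Z Z' c : back_and_forth (tree L) Z ->
  back_and_forth (tree L) Z' -> Z c -> Z' c.
Proof.
move=> bZ bZ' Zc; have [c' [e Zc']] := back_and_forth_total c bZ'.
have [f [g [hf mf]]] := back_and_forth_homeo bZ Zc.
have [f' [g' [hf' mf']]] := back_and_forth_homeo bZ' Zc'.
have [_ _ _ _ orb] := bZ'; apply: orb Zc' _; split=> //.
exists (g' \o f), (g \o f'); split; first exact: homeo_trans hf (homeo_sym hf').
have sz : size c = size c' by rewrite -(size_map snd c) -/(unzip2 c) -e size_map.
have [_ fH _ _ _] := hf; have [_ _ gL' _ fg'] := hf'.
move=> p x /(nthP p)[i]; rewrite size_zip !size_map sz minnn => ilt <- Hx.
have Lfx : L (f x) by apply: fH; exists x.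
have Hgx : H (g' (f x)) by apply: gL'; exists (f x).
pose d := (p.1, p.1).
have -> : nth p (zip (unzip1 c) (unzip1 c')) i = ((nth d c i).1, (nth d c' i).1).
  have -> : nth p (zip (unzip1 c) (unzip1 c')) i = nth (p.1, p.1) (zip (unzip1 c) (unzip1 c')) i.
    by apply: set_nth_default; rewrite size_zip !size_map sz minnn.
  by rewrite nth_zip ?size_map// !(nth_map d) ?sz.
rewrite /= (mf (nth d c i) x) ?mem_nth ?sz// (mf' (nth d c' i) _) ?mem_nth// fg'//.
have -> // : (nth d c' i).2 = (nth d c i).2.
by rewrite -!(nth_map d d.2 snd) ?sz// -/(unzip2 c') -/(unzip2 c) e.
Qed.

End back_and_forth.

(** Bits at numbers coding no list are free, so uniqueness of the system yields a closed section,
    not necessarily a singleton. *)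
Definition coded_back_and_forth (H : set cantor_space) (p : (seq bool -> bool) * (nat -> bool)) :=
  back_and_forth H p.1 (fun c => p.2 (pickle c)).

Lemma Bi_back_and_forth H : Bi (coded_back_and_forth H).
Proof.
pose X := ((seq bool -> bool) * (nat -> bool))%type.
have bZ (c : seq (clopen_code * clopen_code)) : Bi (fun p : X => is_true (p.2 (pickle c))).
  by apply: Bi_lcf; apply: (lcf_map (fun b : bool => is_true b)); apply: (lcf_at (phi := snd)) cts_snd.
have ba t : Bi (fun p : X => is_true (p.1 t)).
  by apply: Bi_lcf; apply: (lcf_map (fun b : bool => is_true b)); apply: (lcf_at (phi := fst)) cts_fst.
apply: (@Bi_ext X _ (fun p : X => p.2 (pickle ([::] : seq (clopen_code * clopen_code))) /\
  ((forall c u, p.2 (pickle c) -> exists v, p.2 (pickle ((u, v) :: c))) /\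
  ((forall c v, p.2 (pickle c) -> exists u, p.2 (pickle ((u, v) :: c))) /\
  ((forall c, p.2 (pickle c) -> consistent H p.1 c) /\
   (forall c c', p.2 (pickle c) -> orbit_equiv H c c' -> p.2 (pickle c'))))))).
  move=> p; split=> [[h1 [h2 [h3 [h4 h5]]]]|[h1 h2 h3 h4 h5]]; first exact: (And5 h1 h2 h3 h4 h5).
  exact: (conj h1 (conj h2 (conj h3 (conj h4 h5)))).
apply: Bi_and; first exact: bZ.
apply: Bi_and.
  apply: Bi_forall => c; apply: Bi_forall => u; apply: Bi_imp => //; exact: Bi_exists.
apply: Bi_and.
  apply: Bi_forall => c; apply: Bi_forall => u; apply: Bi_imp => //; exact: Bi_exists.
apply: Bi_and.
  apply: Bi_forall => c; apply: Bi_imp => //; apply: Bi_and.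
    apply: Bi_forall => s; apply: Bi_imp_const; apply: Bi_exists => t; apply: Bi_and => //.
    exact: Bi_const.
  apply: Bi_forall => t; apply: Bi_imp => //; exact: Bi_const.
apply: Bi_forall => c; apply: Bi_forall => c'; apply: Bi_imp => //; exact: Bi_imp_const.
Qed.

(** The existential clause alone is visibly only analytic. Joined with closedness of the section,
    which uniqueness guarantees for trees of closed sets, it takes the form treated by
    [coanalytic_closed_sections]. *)
Definition homeomorphic_tree H (a : seq bool -> bool) :=
  section_closed (coded_back_and_forth H) a /\
  exists z, coded_back_and_forth H (a, z).

Lemma homeomorphic_treeP H L : closed H -> closed L ->
  homeomorphic_tree H (tree L) <-> homeomorphic L H.
Proof.
move=> cH cL; split=> [[_ [z bz]]|[g [f hgf]]].
  have [Z0 _ _ _ _] := bz; have [f [g [hfg _]]] := back_and_forth_homeo cH cL bz Z0.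
  by exists g, f; exact: homeo_sym hfg.
have bf := homeo_back_and_forth cH cL (homeo_sym hgf); split; last first.
  have [z zE] : exists z : nat -> bool, forall c, z (pickle c) <-> exists f g, homeo H L f g /\ matches H f c.
    exists (fun n => if unpickle n is Some c then `[< exists f g, homeo H L f g /\ matches H f c >] else false).
    by move=> c; rewrite pickleK; split=> /asboolP.
  exists z; rewrite /coded_back_and_forth; move: bf; congr back_and_forth.
  by apply/funext => c; apply/propext; rewrite zE.
move=> z hz; rewrite /coded_back_and_forth; move: bf; congr back_and_forth.
apply/funext => c; apply/propext.
have [z' bz' /cyl_restr zz'] := hz (pickle c).+1.
have zc : (tree L, z).2 (pickle c) = z' (pickle c) by rewrite -[LHS]/(z (pickle c)) zz'.
rewrite zc.
have bf := homeo_back_and_forth cH cL (homeo_sym hgf).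
split=> h; first exact: (@back_and_forth_unique H cH L cL _ (fun c => z' (pickle c)) c bf bz' h).
exact: (@back_and_forth_unique H cH L cL (fun c => z' (pickle c)) _ c bz' bf h).
Qed.

Lemma homeomorphic_tree_coanalytic H : Ana (fun a => ~ homeomorphic_tree H a).
Proof.
(* The root is in the tree of the section exactly when the section is nonempty. *)
have := @coanalytic_closed_sections _ _ (coded_back_and_forth H) (fun b => b [::])
  (Bi_back_and_forth H) _.
move=> h; apply: Ana_ext (h _) => [a|].
  apply: not_iff_compat; split=> -[h1 h2]; split=> //.
    by move/asboolP: h2 => [z hz _]; exists z.
  by have [z hz] := h2; apply/asboolP; exists z.
apply: Ana_lcf; apply: (lcf_map (fun b : bool => ~ b)); exact: lcf_eval.
Qed.

(** * Complexity of Sharp and Blur *)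

Lemma Bi_case {X : Type} {cX : Coded X} (V : countType) (f : X -> V) (P : V -> X -> Prop) :
  lcf f -> (forall v, Bi (P v)) -> Bi (fun x => P (f x) x).
Proof.
move=> hf hP; apply: (@Bi_ext X cX (fun x => exists v, f x = v /\ P v x)).
  by move=> x; split=> [[v [<- //]]|h]; exists (f x).
apply: Bi_exists => v; apply: Bi_and => //; apply: Bi_lcf.
exact: (lcf_map (fun w => w = v)).
Qed.

(** For a [downward] tree this is [relmu tau s < ratr q], by [relmu_lt], written so that its
    complexity is apparent. *)
Definition below (tau : seq bool -> bool) (s : seq bool) (q : rat) : Prop :=
  exists n, rho tau n s < ratr q.

Notation tree_point := ((seq bool -> bool) * (nat -> bool))%type.

Definition ultimately_below (p : tree_point) q :=
  exists N, forall n, (N <= n)%N -> below p.1 (restr p.2 n) q.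

Definition ultimately_not_below (p : tree_point) q :=
  exists N, forall n, (N <= n)%N -> ~ below p.1 (restr p.2 n) q.

Definition converges_at (p : tree_point) := forall q r : rat, q < r ->
  ultimately_not_below p q \/ ultimately_below p r.

Definition sharp_at (p : tree_point) := converges_at p /\
  (exists q : rat, 0 < q /\ ultimately_not_below p q) /\
  (exists q : rat, q < 1 /\ ultimately_below p q).

Lemma lcf_rho n s : lcf (fun tau => rho tau n s).
Proof.
elim: n s => [|n IH] s /=.
  by apply: (lcf_map (fun b : bool => b%:R : Real)); exact: lcf_eval.
by apply: (lcf_map2 (fun x y : Real => (x + y) / 2)).
Qed.

Lemma Bi_below n q : Bi (fun p : tree_point => below p.1 (restr p.2 n) q).
Proof.
apply: (Bi_case (f := fun p : tree_point => restr p.2 n) (P := fun s p => below p.1 s q)).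
  by apply: lcf_mkseq => i; apply: (lcf_at (phi := snd)) cts_snd.
move=> s; apply: Bi_exists => m; apply: Bi_lcf.
apply: (lcf_map (fun x : Real => is_true (x < ratr q))).
exact: (lcf_comp (phi := fst) (lcf_rho m s) cts_fst).
Qed.

Lemma Bi_ultimately_below q : Bi (fun p => ultimately_below p q).
Proof. by apply: Bi_exists => N; apply: Bi_forall => n; apply: Bi_imp_const; exact: Bi_below. Qed.

Lemma Bi_ultimately_not_below q : Bi (fun p => ultimately_not_below p q).
Proof.
by apply: Bi_exists => N; apply: Bi_forall => n; apply: Bi_imp_const; apply: Bi_not; exact: Bi_below.
Qed.

Lemma Bi_converges_at : Bi converges_at.
Proof.
apply: Bi_forall => q; apply: Bi_forall => r; apply: Bi_imp_const; apply: Bi_or.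
  exact: Bi_ultimately_not_below.
exact: Bi_ultimately_below.
Qed.

Lemma Bi_sharp_at : Bi sharp_at.
Proof.
apply: Bi_and; first exact: Bi_converges_at.
apply: Bi_and; apply: Bi_exists => q; apply: Bi_and; try exact: Bi_const.
  exact: Bi_ultimately_not_below.
exact: Bi_ultimately_below.
Qed.

(** Divergence leaves two rationals between the lower and the upper limit. The limit is found as the
    supremum of the eventual lower bounds. *)
Lemma cvg_rational_cuts (r : nat -> Real) : (forall n, 0 <= r n <= 1) ->
  cvgn r <-> forall p q : rat, p < q ->
    (exists N, forall n, (N <= n)%N -> ~ r n < ratr p) \/
    (exists N, forall n, (N <= n)%N -> r n < ratr q).
Proof.
move=> r01; split.
  move=> /cvg_ex[l /cvgrPdist_lt rl] p q pq.
  have pq' : ratr p < ratr q :> Real by rewrite ltr_rat.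
  have [lq|ql] := ltP l (ratr q).
    right; have [N _ hN] := rl (ratr q - l) ltac:(by rewrite subr_gt0).
    by exists N => n /hN /=; rewrite ltr_norml => /andP[]; lra.
  left; have [N _ hN] := rl (l - ratr p) ltac:(by rewrite subr_gt0 (lt_le_trans pq')).
  by exists N => n /hN /=; rewrite ltr_norml => /andP[]; lra.
move=> h; pose E : set Real := [set x | exists N, forall n, (N <= n)%N -> x <= r n].
have supE : has_sup E.
  split; first by exists 0; exists 0%N => n _; have /andP[] := r01 n.
  by exists 1 => x [N hN]; apply: le_trans (hN N _) _ => //; have /andP[] := r01 N.
apply/cvg_ex; exists (sup E); apply/cvgrPdist_lt => e e0.
have [x [N1 hN1] xE] := sup_adherent e0 supE.
have [p] := @rat_in_itvoo _ (sup E) (sup E + e / 2) ltac:(lra).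
rewrite in_itv /= => /andP[p1 p2].
have [q] := @rat_in_itvoo _ (sup E + e / 2) (sup E + e) ltac:(lra).
rewrite in_itv /= => /andP[q1 q2].
have pq : p < q by rewrite -(ltr_rat Real); lra.
have [[N2 hN2]|[N2 hN2]] := h p q pq.
  have : E (ratr p).
    by exists N2 => n /hN2; rewrite leNgt => /negP.
  by move/(sup_upper_bound supE) => ?; exfalso; lra.
exists (maxn N1 N2) => // n /=; rewrite geq_max => /andP[n1 n2].
by have := hN1 n n1; have := hN2 n n2; rewrite ltr_norml => *; apply/andP; split; lra.
Qed.

Section closed_set_densities.
Context (K : set cantor_space) (cK : closed K).
Let dK := @downward_tree K.

Let ratio_below z n q : density_ratio K z n < ratr q <-> below (tree K) (restr z n) q.
Proof. by rewrite density_ratioE//; exact: relmu_lt. Qed.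

Let ratio01 z n : 0 <= density_ratio K z n <= 1.
Proof. by rewrite density_ratioE// relmu_ge0// relmu_le1. Qed.

Lemma converges_atE z : converges_at (tree K, z) <-> density_exists K z.
Proof.
rewrite /density_exists cvg_rational_cuts; last exact: ratio01.
split=> h p q pq; (have [[N hN]|[N hN]] := h p q pq; [left|right]); exists N => n /hN.
- by move=> nb /ratio_below.
- by move/ratio_below.
- by move=> nb /ratio_below.
- by move/ratio_below.
Qed.

Lemma sharp_atE z : sharp_at (tree K, z) <-> Sharp K z.
Proof.
rewrite /sharp_at converges_atE; split.
  move=> [ce [[p [p0 [N hN]]] [q [q1 [M hM]]]]]; split=> //; apply/andP; split.
    apply: (@lt_le_trans _ _ (ratr p)); first by rewrite ltr0q.
    apply: limr_ge => //; exists N => // n /hN nb; rewrite leNgt; apply/negP => /ratio_below.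
    exact: nb.
  apply: (@le_lt_trans _ _ (ratr q)); last by rewrite -(rmorph1 ratr) ltr_rat.
  by apply: limr_le => //; exists M => // n /hM /ratio_below/ltW.
move=> [ce /andP[d0 d1]]; split=> //.
have /cvgrPdist_lt cv : density_ratio K z @ \oo --> density K z by exact: ce.
split.
  have [p] := rat_in_itvoo d0; rewrite in_itv /= => /andP[p0 pd].
  exists p; split; first by rewrite -(ltr0q Real).
  have [N _ hN] := cv (density K z - ratr p) ltac:(by rewrite subr_gt0).
  by exists N => n /hN /=; rewrite ltr_norml => /andP[_ h1] /ratio_below; lra.
have [p] := rat_in_itvoo d1; rewrite in_itv /= => /andP[dp p1].
exists p; split; first by rewrite -(ltr_rat Real) rmorph1.
have [N _ hN] := cv (ratr p - density K z) ltac:(by rewrite subr_gt0).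
by exists N => n /hN /=; rewrite ltr_norml => /andP[h1 _]; apply/ratio_below; lra.
Qed.

(** A set homeomorphic to the compact [H] is itself compact, so closedness of the section is implied
    by the right-hand side. *)
Lemma homeomorphic_coded (D : tree_point -> Prop) (A H : set cantor_space) :
  compact H -> (forall z, D (tree K, z) <-> A z) ->
  (section_closed D (tree K) /\
   homeomorphic_tree H (fun s => `[< section_prefixes D (tree K) s >])) <->
  homeomorphic A H.
Proof.
move=> kH DA.
have -> : (fun s => `[< section_prefixes D (tree K) s >]) = tree A.
  apply/funext => s; apply/asboolP/asboolP => -[z].
    by move=> /DA Az sz; exists z.
  by move=> [/DA Dz sz]; exists z.
have scE : section_closed D (tree K) <-> closed A.
  rewrite closed_cantorP; split=> h z hz.
    by apply/DA/h => n; have [y Ay zy] := hz n; exists y => //; apply/DA.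
  by apply/DA/h => n; have [y /DA Ay zy] := hz n; exists y.
have cH : closed H by exact/compact_cantorP.
rewrite scE; split=> [[cA /homeomorphic_treeP]|h]; first exact.
have cA : closed A by apply/compact_cantorP; exact: homeomorphic_compact h.
by split=> //; apply/homeomorphic_treeP.
Qed.

End closed_set_densities.

(** * Analytic sets of compact sets *)

Section closed_subspace_of_baire.
Context (E : nat -> baire -> Prop).

(** Turns the closed set of a normal form [Ana] into the Polish space that [analytic] asks for. *)
Definition closed_baire := {u : baire | forall n, E n u}.

HB.instance Definition _ := gen_eqMixin closed_baire.
HB.instance Definition _ := gen_choiceMixin closed_baire.

Definition eq_below n (u v : closed_baire) := forall i, (i < n)%N -> sval u i = sval v i.

Definition baire_open (A : set closed_baire) :=
  forall u, A u -> exists n, forall v, eq_below n u v -> A v.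

Lemma baire_openT : baire_open setT.
Proof. by move=> u _; exists 0%N. Qed.

Lemma baire_openI : setI_closed baire_open.
Proof.
move=> A B oA oB u [/oA[n hn] /oB[m hm]]; exists (maxn n m) => v uv; split.
  by apply: hn => i ilt; apply: uv; rewrite leq_max ilt.
by apply: hm => i ilt; apply: uv; rewrite leq_max ilt orbT.
Qed.

Lemma baire_open_bigU (I : Type) (f : I -> set closed_baire) :
  (forall i, baire_open (f i)) -> baire_open (\bigcup_i f i).
Proof.
by move=> of_ u [i _ /of_[n hn]]; exists n => v /hn fv; exists i.
Qed.

HB.instance Definition _ := isOpenTopological.Build closed_baire
  baire_openT baire_openI baire_open_bigU.

Lemma nbhs_eq_below (u : closed_baire) n : nbhs u (eq_below n u).
Proof.
exists (eq_below n u); split=> // v uv; exists n => w vw i ilt.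
by rewrite uv// vw.
Qed.

Definition baire_dist (u v : closed_baire) : Real :=
  if pselect (exists n, sval u n != sval v n) is left h then 2^-1 ^+ ex_minn h else 0.

Lemma eq_belowW n m u v : (n <= m)%N -> eq_below m u v -> eq_below n u v.
Proof. by move=> nm h i ilt; apply: h; exact: leq_trans nm. Qed.

Lemma baire_dist_lt u v n : eq_below n.+1 u v -> baire_dist u v < 2^-1 ^+ n.
Proof.
rewrite /baire_dist; case: pselect => [h uv|_ _]; last by rewrite exprn_gt0// invr_gt0.
case: ex_minnP => k hk _; have nk : (n < k)%N.
  by rewrite ltnNge; apply/negP => kn; move/eqP: hk; apply; exact: uv.
by rewrite ltr_iXn2l// ?invr_gt0// invf_lt1// ltr1n.
Qed.

Lemma baire_dist_ge u v n : ~ eq_below n.+1 u v -> 2^-1 ^+ n <= baire_dist u v.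
Proof.
move=> nuv; have /existsNP[i /not_implyP[ilt /eqP hi]] := nuv.
rewrite /baire_dist; case: pselect => [h|[]]; last by exists i.
case: ex_minnP => k _ /(_ i hi) ki; apply: half_exp_le; exact: leq_trans ki ilt.
Qed.

Lemma closed_baire_eqP (u v : closed_baire) : (forall i, sval u i = sval v i) -> u = v.
Proof.
case: u v => [u hu] [v hv] /= /funext e; subst v; congr exist; exact: Prop_irrelevance.
Qed.

Lemma baire_dist_ge0 u v : 0 <= baire_dist u v.
Proof. by rewrite /baire_dist; case: pselect => *; rewrite ?exprn_ge0. Qed.

Lemma baire_dist0 u v : baire_dist u v = 0 <-> u = v.
Proof.
split=> [d0|->].
  apply: closed_baire_eqP => i; apply: contrapT => ne.
  have : ~ eq_below i.+1 u v by move/(_ i (ltnSn i)).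
  by move/baire_dist_ge; rewrite d0 leNgt exprn_gt0// invr_gt0.
by rewrite /baire_dist; case: pselect => // h; exfalso; case: h => n; rewrite eqxx.
Qed.

Lemma baire_dist_sym u v : baire_dist u v = baire_dist v u.
Proof.
have le u1 v1 : baire_dist u1 v1 <= baire_dist v1 u1.
  rewrite {1}/baire_dist; case: pselect => [h|_]; last exact: baire_dist_ge0.
  case: ex_minnP => k hk _; apply: baire_dist_ge => /(_ k (ltnSn k)) e.
  by rewrite e eqxx in hk.
by apply/le_anti; rewrite !le.
Qed.

Lemma baire_dist_triangle u v w : baire_dist u w <= baire_dist u v + baire_dist v w.
Proof.
rewrite {1}/baire_dist; case: pselect => [h|_]; last by rewrite addr_ge0// baire_dist_ge0.
case: ex_minnP => k hk _.
have [uv|/baire_dist_ge h1] := pselect (eq_below k.+1 u v); last first.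
  by apply: le_trans h1 _; rewrite lerDl baire_dist_ge0.
have [vw|/baire_dist_ge h1] := pselect (eq_below k.+1 v w); last first.
  by apply: le_trans h1 _; rewrite lerDr baire_dist_ge0.
by move: hk; rewrite uv// vw// eqxx.
Qed.

Lemma eq_below_of_dist u v n : baire_dist u v < 2^-1 ^+ n -> eq_below n.+1 u v.
Proof. by move=> h; apply: contrapT => /baire_dist_ge; rewrite leNgt h. Qed.

Lemma closed_baire_separable : separable_space closed_baire.
Proof.
have [[u0 _]|nu] := pselect (exists u : closed_baire, True); last first.
  exists set0; split; first exact: countable0.
  by apply/seteqP; split=> u // _; exfalso; apply: nu; exists u.
pose d (s : seq nat) : closed_baire :=
  xget u0 [set u | forall i, (i < size s)%N -> sval u i = nth 0%N s i].
exists (range d); split.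
  by apply: (@sub_countable _ _ _ [set: seq nat]); [exact: card_image_le|exact: countableP].
apply/seteqP; split=> // u _ A; rewrite nbhsE => -[B [oB Bu] BA].
have [n hn] := oB u Bu; exists (d (mkseq (sval u) n)); split; first by exists (mkseq (sval u) n).
apply/BA/hn => i ilt; set s := mkseq (sval u) n.
have ex : exists v, [set v : closed_baire | forall i, (i < size s)%N -> sval v i = nth 0%N s i] v.
  by exists u => j; rewrite size_mkseq => jn; rewrite nth_mkseq.
by have /= -> := xgetPex u0 ex i; rewrite ?size_mkseq ?nth_mkseq.
Qed.

Lemma closed_baire_polish : (forall n, lcf (E n)) -> polish closed_baire.
Proof.
move=> hE; split; first exact: closed_baire_separable.
exists baire_dist; split.
- by split; [exact: baire_dist_ge0|exact: baire_dist0].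
- exact: baire_dist_sym.
- exact: baire_dist_triangle.
- move=> A; split=> [oA u Au|h]; last suff : baire_open A by [].
    have [n hn] : exists n, forall v, eq_below n u v -> A v by exact: oA.
    exists (2^-1 ^+ n); first by rewrite exprn_gt0// invr_gt0.
    by move=> v /eq_below_of_dist/(eq_belowW (leqnSn n)); exact: hn.
  move=> u /h[e e0 he]; have [n hn] := half_exp_lt e0; exists n.+1 => v uv; apply: he.
  exact: lt_trans (baire_dist_lt uv) hn.
- move=> u cu.
  have [N hN] := choice (fun k => cu (2^-1 ^+ k) ltac:(by rewrite exprn_gt0// invr_gt0)).
  have stable k m n : (N k <= m)%N -> (N k <= n)%N -> eq_below k.+1 (u m) (u n).
    by move=> hm hn; apply: eq_below_of_dist; exact: hN.
  pose w : baire := fun k => sval (u (N k)) k.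
  have wu k : exists M, forall n, (M <= n)%N -> forall i, (i < k)%N -> w i = sval (u n) i.
    elim: k => [|k [M IH]]; first by exists 0%N.
    exists (maxn M (N k)) => n; rewrite geq_max => /andP[Mn Nn] i; rewrite ltnS leq_eqVlt.
    by move=> /orP[/eqP->|]; [apply: stable|exact: IH].
  have Ew n : E n w.
    have [m hm] := hE n w; have [k hk] := @agree_seq nat m; have [M hM] := wu k.
    rewrite -(hm (sval (u M))); first exact: (svalP (u M)).
    by apply: hk => i ilt; exact: hM.
  exists (exist _ w Ew) => e e0; have [k hk] := half_exp_lt e0; have [M hM] := wu k.+1.
  exists M => n Mn; rewrite baire_dist_sym; apply: lt_trans hk; apply: baire_dist_lt => i ilt /=.
  exact: hM.
Qed.

End closed_subspace_of_baire.

(** Points of [P] and their witnesses, interleaved at even and odd places, form a closed set mapped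
    onto the image. Continuity of [phi] is relative to [P], as decoding a compact set is controlled
    on pruned trees. *)
Lemma analytic_of_Ana (T : topologicalType) (P : baire -> Prop) (phi : baire -> T) :
  Ana P ->
  (forall w, P w -> forall U, nbhs (phi w) U -> exists n, forall w', P w' ->
     (forall i, (i < n)%N -> w i = w' i) -> U (phi w')) ->
  analytic (phi @` P).
Proof.
move=> [C [hC PC]] cphi; right.
pose ev (u : baire) : baire := fun i => u i.*2.
pose od (u : baire) : baire := fun i => u i.*2.+1.
pose E n (u : baire) := C n (ev u, od u).
have Pev (u : closed_baire E) : P (ev (sval u)).
  by apply/PC; exists (od (sval u)) => n; exact: (svalP u n).
exists (closed_baire E), (fun u => phi (ev (sval u))); split.
- apply: closed_baire_polish => n; apply: lcf_comp (hC n) _.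
  by apply: cts_pair; apply: cts_fun => i; exact: lcf_eval.
- move=> u U /(cphi _ (Pev u))[n hn].
  apply: filterS (nbhs_eq_below u n.*2) => v uv; apply: hn; first exact: Pev.
  by move=> i ilt; apply: uv; rewrite ltn_double.
- apply/seteqP; split=> [_ [u _ <-]|_ [w Pw <-]]; first by exists (ev (sval u)).
  have [y hy] := (PC w).1 Pw.
  pose u : baire := fun i => if odd i then y i./2 else w i./2.
  have evu : ev u = w by apply/funext => i; rewrite /ev /u odd_double doubleK.
  have odu : od u = y by apply/funext => i; rewrite /od /u oddS odd_double/= uphalf_double.
  have Eu n : E n u by rewrite /E evu odu.
  by exists (exist _ u Eu) => //=; rewrite evu.
Qed.

(** * Compact sets coded by pruned trees *)

Definition pruned (tau : seq bool -> bool) :=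
  forall s, tau s = tau (rcons s false) || tau (rcons s true).

Definition branches (tau : seq bool -> bool) : set cantor_space :=
  [set y | forall n, tau (restr y n)].

Lemma branches_compact tau : compact (branches tau).
Proof.
apply/compact_cantorP/closed_cantorP => x hx n.
have [y hy /cyl_restr xy] := hx n.
by rewrite (restr_eq (y := y))// => i ilt; rewrite xy.
Qed.

Lemma tree_branches tau : pruned tau -> tree (branches tau) = tau.
Proof.
move=> pt; have down s t : tau (s ++ t) -> tau s.
  elim/last_ind: t => [|t b IH]; first by rewrite cats0.
  by rewrite -rcons_cat => h; apply: IH; rewrite pt; case: b h => ->; rewrite ?orbT.
apply/funext => s; apply/asboolP/idP => [[y [hy sy]]|ts].
  by have := hy (size s); rewrite ((cylP s y).1 sy).
apply: contrapT => nb.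
have [||n hn] := @fan (fun t => ~ tau (s ++ t)).
- by move=> t u h h'; apply: h; apply: (down _ u); rewrite -catA.
- move=> x; apply: contrapT => /forallNP h; apply: nb; exists (app s x); split; last exact: cyl_app.
  move=> n; have := contrapT (h n); rewrite -restr_app => hn.
  by apply: (down _ (drop n (restr (app s x) (size s + n)))); rewrite -[X in X ++ _](take_restr _ (leq_addl (size s) n)) cat_take_drop.
suff [t st tt] : exists2 t, size t = n & tau (s ++ t) by exact: hn st tt.
elim: n {hn} => [|n [t st tt]]; first by exists [::]; rewrite ?cats0.
move: tt; rewrite pt => /orP[] h; [exists (rcons t false)|exists (rcons t true)];
  by rewrite ?size_rcons ?st// -rcons_cat.
Qed.

Lemma branches_tree K : closed K -> branches (tree K) = K.
Proof.
move=> /closed_cantorP cK; apply/seteqP; split=> y hy.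
  by apply: cK => n; have /asboolP[x []] := hy n; exists x.
by move=> n; apply/asboolP; exists y; split=> //; exact: cyl_restr_self.
Qed.

Definition decode_tree (w : baire) : seq bool -> bool := fun s => w (pickle s) != 0%N.

Definition compact_of_code (w : baire) : compK := CompK (@branches_compact (decode_tree w)).

Lemma compK_eqP (K L : compK) : Kset K = Kset L -> K = L.
Proof.
by case: K L => [K kK] [L kL] /= e; subst L; congr CompK; exact: Prop_irrelevance.
Qed.

Lemma analytic_compK (P : (seq bool -> bool) -> Prop) :
  Ana P -> analytic [set K | P (tree (Kset K))].
Proof.
move=> aP.
have cd : cts decode_tree.
  by apply: cts_fun => s; apply: (lcf_map (fun k => k != 0%N)); exact: lcf_eval.
have aPd : Ana (fun w => pruned (decode_tree w) /\ P (decode_tree w)).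
  apply: Ana_and; last exact: Ana_comp aP cd.
  apply: Ana_forall => s; apply: Ana_lcf.
  have l t : lcf (fun w => decode_tree w t) by exact: lcf_at.
  exact: (lcf_map2 (fun b c : bool => b = c) (l s) (lcf_map2 orb (l _) (l _))).
suff -> : [set K | P (tree (Kset K))] = compact_of_code @` [set w | pruned (decode_tree w) /\ P (decode_tree w)].
  apply: analytic_of_Ana aPd _ => w [pw _] U /nbhs_compK[n hn].
  (* Exceeds the codes of all strings of length at most [n], so agreement of [w] and [w'] below [m]
     fixes the tree up to level [n]. *)
  pose m := \max_(k < n.+1) \max_(s <- strings k) (pickle s).+1.
  exists m => w' [pw' _] ww'; apply: hn => t tn /=; rewrite !tree_branches// /decode_tree ww'//.
  apply: (@leq_trans (\max_(s <- strings (size t)) (pickle s).+1)).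
    by rewrite (@leq_bigmax_seq _ _ xpredT (fun s => (pickle s).+1))// mem_strings.
  exact: (@leq_bigmax _ (fun k : 'I_n.+1 => \max_(s <- strings k) (pickle s).+1) (Ordinal (tn : (size t < n.+1)%N))).
apply/seteqP; split=> [K PK|_ [w [pw Pw] <-]]; last by rewrite /= tree_branches.
pose w n := if unpickle n is Some s then (tree (Kset K) s : nat) else 0%N.
have dw : decode_tree w = tree (Kset K).
  by apply/funext => s; rewrite /decode_tree /w pickleK; case: (tree _ s).
exists w; first by rewrite /= dw; split=> // s; exact: tree_rcons.
apply: compK_eqP; rewrite /= dw branches_tree//.
exact/compact_cantorP/Kset_compact.
Qed.

Lemma coanalytic_homeomorphism_class (A : set cantor_space -> set cantor_space)
  (D : tree_point -> Prop) (H : compK) : Bi D ->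
  (forall K, closed K -> forall z, D (tree K, z) <-> A K z) ->
  coanalytic [set K : compK | homeomorphic (A (Kset K)) (Kset H)].
Proof.
move=> bD DA; rewrite /coanalytic.
have := analytic_compK (coanalytic_closed_sections bD (@homeomorphic_tree_coanalytic (Kset H))).
congr analytic; apply/funext => K; apply/propext; rewrite /=.
have cK : closed (Kset K) by exact/compact_cantorP/Kset_compact.
by rewrite (homeomorphic_coded (A := A (Kset K)) _ (DA _ cK))//; exact: Kset_compact.
Qed.

Theorem theorem6p6 (H : compK) :
  Pi11_complete (Shrp H) /\ Pi11_complete (Blr H).
Proof.
have kH := @Kset_compact H; have cH := (compact_cantorP _).1 kH.
split; split.
- exact: coanalytic_homeomorphism_class Bi_sharp_at sharp_atE.
- apply: (hard_gadget kH (A := fun K => Sharp (Kset K)) sharp_value_bounds) => T K ->.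
  exact: Sharp_spine.
- apply: (@coanalytic_homeomorphism_class Blur _ _ (Bi_not Bi_converges_at)) => K cK z.
  by rewrite converges_atE.
- apply: (hard_gadget kH (A := fun K => Blur (Kset K)) blur_value_bounds) => T K ->.
  exact: Blur_spine.
Qed.
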